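(* Let $\mathcal X,\mathcal Y$ be real separable Hilbert spaces with $\mathcal X$ infinite-dimensional, let $B>0$, $\sigma>0$, $k\in\mathbb N_0$, $0<\alpha\le1$, $1\le p<\infty$, let $\mu$ be a probability measure on $\mathcal X$ satisfying conditions (i), (ii), (iii-L), (iii-U) of the context, and suppose the noise is Hilbert-valued Gaussian noise. Then for every $q>0$, $$\limsup_{m\to\infty}\ \mathcal M_m(\mathcal F;L^p_\mu)\cdot m^q=+\infty,$$ where $\mathcal F=\mathcal F^{k,\alpha}_B$ and $\mathcal M_m(\mathcal F;L^p_\mu)$ is either the fixed-design or the random-design minimax risk.
   Context: Conditions on $\mu$ (a Borel probability measure on $\mathcal X$): (i) $\mu$ has mean zero and $\int_{\mathcal X}\|X\|_{\mathcal X}^2\,d\mu(X)<\infty$. (ii) Let $\lambda_1\ge\lambda_2\ge\cdots>0$ and $\{\phi_i\}_i\subset\mathcal X$ be the eigenvalues and an orthonormal basis of eigenvectors of the covariance operator of $\mu$. The real random variables $\xi_i=\langle X,\phi_i\rangle_{\mathcal X}/\sqrt{\lambda_i}$, $X\sim\mu$, are independent. (iii-L) Each $\xi_i$ has a density $\nu_i$ with respect to Lebesgue measure, and there are constants $a,b>0$ (independent of $i$) with $\nu_i(x)\ge b$ for all $|x|\le a$ and all $i$. (iii-U) With $p'=\max\{p,2\}$, $\sup_i(\mathbb E|\xi_i|^{p'})^{1/p'}<\infty$. Observations: $Y_i=F(X_i)+\sigma E_i$, $i=1,\dots,m$. Hilbert-valued Gaussian noise: $E_1,\dots,E_m$ are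 i.i.d. mean-zero Gaussian random elements of $\mathcal Y$ with covariance operator $\Upsilon$, $\mathrm{Tr}(\Upsilon)=1$. Class: $\mathcal L^j(\mathcal X;\mathcal Y)$ is the space of continuous $j$-linear maps from $\mathcal X$ to $\mathcal Y$ with the operator norm ($\mathcal L^0=\mathcal Y$), and $D^jF(X)\in\mathcal L^j(\mathcal X;\mathcal Y)$ is the $j$th Fréchet derivative ($D^0F=F$). $C^{k,\alpha}(\mathcal X;\mathcal Y)$ is the space of $k$-times differentiable $F:\mathcal X\to\mathcal Y$ whose $k$th derivative is $\alpha$-Hölder continuous, with norm $\|F\|_{C^{k,\alpha}}=\sum_{j=0}^k\sup_{X\in\mathcal X}\|D^jF(X)\|_{\mathcal L^j(\mathcal X;\mathcal Y)}+[D^kF]_\alpha$, where $[D^kF]_\alpha=\sup_{X\ne X'}\|D^kF(X)-D^kF(X')\|_{\mathcal L^k(\mathcal X;\mathcal Y)}/\|X-X'\|_{\mathcal X}^\alpha$. $\mathcal F^{k,\alpha}_B=\{F\in C^{k,\alpha}(\mathcal X;\mathcal Y):\|F\|_{C^{k,\alpha}}\le B\}$. Norm: $\|F\|_{L^p_\mu(\mathcal X;\mathcal Y)}=(\int_{\mathcal X}\|F(X)\|_{\mathcal Y}^p\,d\mu(X))^{1/p}$. Minimax risks: an estimator $\widehat F$ is a mapping from the data to $L^p_\mu(\mathcal X;\mathcal Y)$. Fixed design: $\mathcal M_m(\mathcal F;L^p_\mu)=\inf_{\mathcal D}\inf_{\widehat F}\sup_{F\in\mathcal F}\mathbb E\|F-\widehat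 F\|_{L^p_\mu(\mathcal X;\mathcal Y)}$, with infimum over designs $\mathcal D=\{X_1,\dots,X_m\}\subset\mathcal X$ and expectation over the $E_i$. Random design: $\mathcal M_m(\mathcal F;L^p_\mu)=\inf_\nu\inf_{\widehat F}\sup_{F\in\mathcal F}\mathbb E\|F-\widehat F\|_{L^p_\mu(\mathcal X;\mathcal Y)}$, with infimum over probability measures $\nu$ on $\mathcal X$, $X_1,\dots,X_m$ i.i.d. from $\nu$ independent of the $E_i$, and expectation over the $X_i$ and $E_i$. *)

(* Defs.v *)
From HB Require Import structures.
From mathcomp Require Import all_boot all_order all_algebra finmap.
From mathcomp Require Import all_classical all_reals all_analysis measurable_realfun.

Set Implicit Arguments.
Unset Strict Implicit.
Unset Printing Implicit Defensive.

Import Order.TTheory GRing.Theory Num.Theory.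
Import numFieldNormedType.Exports.

Local Open Scope classical_set_scope.
Local Open Scope ring_scope.

(** * Real Hilbert spaces *)

HB.mixin Record CompleteNormedModule_isHilbert (R : realType) (V : Type)
    of CompleteNormedModule R V := {
  inner : V -> V -> R ;
  innerC : forall x y, inner x y = inner y x ;
  innerD : forall x y z, inner (x + y) z = inner x z + inner y z ;
  innerZ : forall a x y, inner (a *: x) y = a * inner x y ;
  inner_norm : forall x, inner x x = `|x| ^+ 2
}.

#[short(type="hilbertType")]
HB.structure Definition Hilbert (R : realType) :=
  {V of CompleteNormedModule R V & CompleteNormedModule_isHilbert R V}.

Definition separable (T : topologicalType) : Prop :=
  exists2 D : set T, countable D & dense D.

Definition infinite_dimensional (R : realType) (V : lmodType R) : Prop :=
  forall (n : nat) (v : 'I_n -> V),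
    exists x : V, forall c : 'I_n -> R, x != \sum_(i < n) c i *: v i.

(* Orthonormal basis (complete orthonormal system) indexed by a set [D] of
   natural numbers, which may be finite. *)
Definition orthonormal_basis (R : realType) (V : hilbertType R)
    (D : set nat) (e : nat -> V) : Prop :=
  (forall i j, D i -> D j -> inner (e i) (e j) = (i == j)%:R) /\
  (forall x : V,
    (\sum_(i < n | `[< D i >]) inner x (e i) *: e i) @[n --> \oo] --> x).

(** * Measures on Hilbert spaces *)

Notation borel T := (g_sigma_algebraType (@open T)).

Section HilbertMeasures.
Context {R : realType} {V : hilbertType R}.
Local Open Scope ereal_scope.

(* The mean of [P] in the weak (Pettis) sense. *)
Definition is_mean (P : probability (borel V) R) (m : V) : Prop :=
  forall h : V, P.-integrable setT (fun x => (inner (x : V) h)%:E) /\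
    \int[P]_x (inner (x : V) h)%:E = (inner m h)%:E.

(* Covariance operator of a centred measure: E (X \otimes X). *)
Definition is_covariance (P : probability (borel V) R) (C : V -> V) : Prop :=
  forall g h : V,
    P.-integrable setT (fun x => (inner (x : V) g * inner (x : V) h)%:E) /\
    \int[P]_x (inner (x : V) g * inner (x : V) h)%:E = (inner (C g) h)%:E.

(* Trace of a positive semi-definite operator; it does not depend on the
   orthonormal basis in which it is computed. *)
Definition has_trace (C : V -> V) (t : R) : Prop :=
  exists D e, orthonormal_basis D e /\
    \esum_(i in D) (inner (C (e i)) (e i))%:E = t%:E.

(* [normal_prob m 0] is not the point mass at [m] in the library. *)
Definition gaussian_real (m s : R) (A : set R) : \bar R :=
  if s == 0%R then \d_m A else normal_prob m s A.

(* Every one-dimensional marginal is a, possibly degenerate, normal law. *)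
Definition is_gaussian (P : probability (borel V) R) : Prop :=
  forall h : V, exists m s : R, forall A : set R, measurable A ->
    P [set x | A (inner (x : V) h)] = gaussian_real m s A.

End HilbertMeasures.

Section Probability.
Local Open Scope ereal_scope.

(* Mutual independence: product rule over every finite subfamily. *)
Definition mutually_independent d (T : measurableType d) (R : realType)
    (P : probability T R) (I : choiceType) (xi : I -> T -> R) : Prop :=
  (forall i, measurable_fun setT (xi i)) /\
  forall (J : {fset I}) (A : I -> set R),
    (forall i, measurable (A i)) ->
    P (\bigcap_(i in [set` J]) xi i @^-1` A i)
    = \prod_(i <- J) P (xi i @^-1` A i).

Definition has_density d (T : measurableType d) (R : realType)
    (P : probability T R) (xi : T -> R) (nu : R -> R) : Prop :=
  [/\ measurable_fun setT nu, forall x, (0 <= nu x)%R &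
    forall A : set R, measurable A ->
      P (xi @^-1` A) = \int[lebesgue_measure]_(x in A) (nu x)%:E].

End Probability.

(** * Product laws on tuples *)

Section Iid.
Context d (T : measurableType d) (R : realType).

Definition tuple_cons n (w : T * n.-tuple T) : n.+1.-tuple T :=
  [the n.+1.-tuple T of w.1 :: w.2].

Lemma measurable_tuple_cons n : measurable_fun setT (@tuple_cons n).
Proof. exact: measurable_cons measurable_fst measurable_snd. Qed.

HB.instance Definition _ n :=
  isMeasurableFun.Build _ _ _ _ (@tuple_cons n) (@measurable_tuple_cons n).

(* The law of [n] i.i.d. draws from [P]. *)
Fixpoint iid_law (P : probability T R) n : probability (n.-tuple T) R :=
  match n with
  | 0 => \d_[tuple]
  | n'.+1 => distribution (P \x iid_law P n')%E (@tuple_cons n')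
  end.

End Iid.

(** * The class of C^{k,alpha} maps *)

Section Smoothness.
Context {R : realType} {X Y : normedModType R}.

(* Elements of L^j(X; Y) are represented as functions of ['I_j -> X];
   [dfwith v i x] is [v] with its [i]-th entry replaced by [x]. *)
Definition continuous_multilinear j (T : ('I_j -> X) -> Y) : Prop :=
  (forall (v : 'I_j -> X) (i : 'I_j), linear (fun x : X => T (dfwith v i x))) /\
  continuous (T : {ptws 'I_j -> X} -> Y).

Definition opnorm j (T : ('I_j -> X) -> Y) : \bar R :=
  ereal_sup [set `|T v|%:E | v in [set v | forall i, `|v i| <= 1]].

Definition cons_dir j (h : X) (v : 'I_j -> X) : 'I_j.+1 -> X :=
  fun i => oapp v h (unlift ord0 i).

(* [D j] is the [j]-th Frechet derivative of [F] for all [j <= k], under the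
   usual identification of L(X; L^j(X; Y)) with L^{j+1}(X; Y).  The values of
   [D j] for [j <= k] are determined by [F]. *)
Definition frechet_derivatives k (F : X -> Y)
    (D : forall j, X -> ('I_j -> X) -> Y) : Prop :=
  [/\ forall x v, D 0%N x v = F x,
      forall j x, (j <= k)%N -> continuous_multilinear (D j x) &
      forall j x, (j < k)%N ->
        (opnorm (fun v => (D j (x + h) v - D j x v - D j.+1 x (cons_dir h v))%R)
          * (`|h|^-1)%:E)%E @[h --> (0 : X)^'] --> 0%E].

Definition holder_seminorm j (alpha : R) (G : X -> ('I_j -> X) -> Y) : \bar R :=
  ereal_sup [set t | exists x x' : X, x != x' /\
    t = (opnorm (fun v => (G x v - G x' v)%R)
          * ((`|x - x'| `^ alpha)^-1)%:E)%E].

Definition C_norm k (alpha : R) (D : forall j, X -> ('I_j -> X) -> Y) : \bar R :=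
  (\sum_(j < k.+1) ereal_sup (range (fun x => opnorm (D j x)))
    + holder_seminorm alpha (D k))%E.

Definition C_ball k (alpha B : R) : set (X -> Y) :=
  [set F | exists D, frechet_derivatives k F D /\ (C_norm k alpha D <= B%:E)%E].

End Smoothness.

(** * Minimax risks *)

Section Minimax.
Context {R : realType} {X Y : hilbertType R}.
Local Open Scope ereal_scope.

Definition Lp_norm (mu : probability (borel X) R) (p : R) (F : X -> Y) : \bar R :=
  'N[mu]_p%:E[(fun x => `|F x|%:E)].

(* Elements of L^p_mu(X; Y) are represented by functions.  The only
   measurability asked of the map [data |-> Fhat data] is that the losses whose
   expectations enter the risk over the class [FF] are measurable. *)
Definition estimator d (data : measurableType d) (mu : probability (borel X) R)
    (p : R) (FF : set (X -> Y)) (Fhat : data -> X -> Y) : Prop :=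
  (forall w, measurable_fun setT (Fhat w : borel X -> borel Y) /\
    Lp_norm mu p (Fhat w) < +oo) /\
  (forall F, FF F ->
    measurable_fun setT (fun w => Lp_norm mu p (F \- Fhat w)%R)).

(* [gamma] is the law of the noise. *)
Variables (mu : probability (borel X) R) (p sigma : R).
Variables (gamma : probability (borel Y) R) (FF : set (X -> Y)).

Definition responses m (F : X -> Y) (x : m.-tuple X) (e : m.-tuple Y)
    : m.-tuple (borel Y) :=
  [tuple F (tnth x i) + sigma *: tnth e i | i < m]%R.

Definition observations m (F : X -> Y) (x : m.-tuple X) (e : m.-tuple Y)
    : m.-tuple (borel X * borel Y)%type :=
  [tuple (tnth x i, tnth (responses F x e) i) | i < m].

Definition fixed_design_risk (m : nat) : \bar R :=
  ereal_inf [set ereal_inf [set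
    ereal_sup [set \int[iid_law gamma m]_e
                     Lp_norm mu p (F \- Fhat (responses F x e))%R
              | F in FF]
    | Fhat in @estimator _ (m.-tuple (borel Y)) mu p FF]
  | x in [set: m.-tuple X]].

Definition random_design_risk (m : nat) : \bar R :=
  ereal_inf [set ereal_inf [set
    ereal_sup [set \int[iid_law nu m \x iid_law gamma m]_w
                     Lp_norm mu p (F \- Fhat (observations F w.1 w.2))%R
              | F in FF]
    | Fhat in @estimator _ (m.-tuple (borel X * borel Y)%type) mu p FF]
  | nu in [set: probability (borel X) R]].

End Minimax.

(** * Assumptions on the sampling measure *)

Section Conditions.
Context {R : realType} {X : hilbertType R}.
Variable mu : probability (borel X) R.
Local Open Scope ereal_scope.

Definition centred_square_integrable : Prop :=
  is_mean mu 0%R /\ \int[mu]_x (`|x : X| ^+ 2)%:E < +oo.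

Variables (lambda : nat -> R) (phi : nat -> X).

Definition covariance_eigensystem : Prop :=
  [/\ nonincreasing_seq lambda, forall i, (0 < lambda i)%R,
      orthonormal_basis setT phi &
      exists C : X -> X, is_covariance mu C /\
        forall i, C (phi i) = (lambda i *: phi i)%R].

Definition kl_coord (i : nat) (x : borel X) : R :=
  (inner (x : X) (phi i) / Num.sqrt (lambda i))%R.

Definition kl_density_lower : Prop :=
  exists (nu : nat -> R -> R) (a b : R),
    [/\ (0 < a)%R, (0 < b)%R, forall i, has_density mu (kl_coord i) (nu i) &
        forall i x, (`|x| <= a -> b <= nu i x)%R].

Definition kl_moment_upper (p : R) : Prop :=
  ereal_sup (range (fun i =>
    'N[mu]_(Num.max p 2)%:E[(fun x => (kl_coord i x)%:E)])) < +oo.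

End Conditions.

(* Main.v *)
Require Import Defs.
From mathcomp Require Import all_boot all_order all_algebra finmap.
From mathcomp Require Import all_classical all_reals all_analysis measurable_realfun.
From mathcomp Require Import ring lra.

Set Implicit Arguments.
Unset Strict Implicit.
Unset Printing Implicit Defensive.

Import Order.TTheory GRing.Theory Num.Theory.
Import numFieldNormedType.Exports.
Local Open Scope classical_set_scope.
Local Open Scope ring_scope.

(** Values at [m] points, even exact ones, leave an element of the class undetermined
    away from these points, and this ambiguity has large mass because infinitely
    many directions of [X] carry mass under [mu].

    Fix a dimension [d].  In the first [d] Karhunen-Loeve coordinates [xi i], cut
    the cube [[0, a]^d] into [N^d] cells, with [N = 2 n], and put in each cell a
    smooth bump of height [h], of order [N^-(k+1)]; this height is small enough for
    every signed sum [F tau] of these bumps, taken in a fixed unit direction of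
    [Y], to lie in the ball of radius [B] ([bump_sum_C_ball]).  Since distinct cells
    are disjoint, the bounds do not deteriorate with the number of cells.

    A design of [m = n^d] points misses at least half of the cells
    ([card_free_cells]).  Changing all signs [tau c] on the missed cells leaves
    the observations unchanged, noise included, but moves [F tau] by at least
    [2 h kappa^d] on the cores of the missed cells.  By independence of the
    coordinates and the lower bound on their densities, each core has
    mu-measure at least of order [N^-d] ([cell_core_measure]), so that the cores
    of the missed cells together have measure bounded below independently of
    [n].  The triangle inequality in [L^p] bounds the sum of the losses for the
    two sign patterns; averaging over all sign patterns, which is legitimate
    because the family does not depend on the design, gives a lower bound that
    holds for deterministic and for random designs alike
    ([fixed_design_risk_ge], [random_design_risk_ge]).

    Hence both risks at [m = n^d] are at least [c n^-(k+1)] ([risk_ge_poly]).  As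
    [X] has infinitely many coordinates, [d] can be taken with [d q >= k + 2], and
    then the risk multiplied by [m^q = n^(d q)] is at least [c n]. *)

(** * A one-dimensional bump with vanishing end derivatives *)

Lemma sqrnormE (R : realDomainType) (x : R) : `|x| ^+ 2 = x ^+ 2.
Proof. exact: real_normK (num_real x). Qed.

Lemma poly_bounded (R : realFieldType) (P : {poly R}) :
  exists C, 0 <= C /\ forall a, 0 <= a <= 1 -> `|P.[a]| <= C.
Proof.
elim/poly_ind: P => [|P c [C [C0 CP]]].
  by exists 0; split=> // a _; rewrite horner0 normr0.
exists (C + `|c|); split; first by rewrite addr_ge0.
move=> a a01; rewrite hornerMXaddC (le_trans (ler_normD _ _))// lerD2r.
case/andP: (a01) => a0 a1; rewrite normrM (ger0_norm a0).
by rewrite -[leRHS]mulr1 ler_pM// CP.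
Qed.

(** Writing [P = Q X + c], the remainder for [P] is [a] times the one for [Q] plus
    [Q'(b) (a - b)^2], which permits an induction on [P]. *)
Lemma poly_taylor (R : realFieldType) (P : {poly R}) :
  exists C, 0 <= C /\ forall a b, 0 <= a <= 1 -> 0 <= b <= 1 ->
    `|P.[a] - P.[b] - (a - b) * P^`().[b]| <= C * (a - b) ^+ 2.
Proof.
elim/poly_ind: P => [|P c [C [C0 CP]]].
  by exists 0; split=> // a b _ _; rewrite deriv0 !horner0 mulr0 !subr0 normr0 mul0r.
have [C' [C'0 CP']] := poly_bounded P^`().
exists (C + C'); split; first by rewrite addr_ge0.
move=> a b a01 b01; case/andP: (a01) => a0 a1.
rewrite derivD derivC addr0 derivM derivX !hornerMXaddC hornerD hornerMX hornerM.
rewrite hornerC (_ : _ - _ = a * (P.[a] - P.[b] - (a - b) * P^`().[b])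
  + P^`().[b] * (a - b) ^+ 2); last by ring.
rewrite (le_trans (ler_normD _ _))// [leRHS]mulrDl lerD// normrM.
  rewrite (ger0_norm a0) -[leRHS]mul1r ler_pM//; exact: CP.
by rewrite (ger0_norm (sqr_ge0 _)) ler_wpM2r ?sqr_ge0// CP'.
Qed.

Lemma poly_lip (R : realFieldType) (P : {poly R}) :
  exists C, 0 <= C /\ forall a b, 0 <= a <= 1 -> 0 <= b <= 1 ->
    `|P.[a] - P.[b]| <= C * `|a - b|.
Proof.
have [C [C0 CP]] := poly_taylor P; have [C' [C'0 CP']] := poly_bounded P^`().
exists (C + C'); split; first by rewrite addr_ge0.
move=> a b a01 b01; rewrite -[_ - _](subrK ((a - b) * P^`().[b])).
rewrite (le_trans (ler_normD _ _))// [leRHS]mulrDl lerD//.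
  rewrite (le_trans (CP _ _ _ _))// ler_wpM2l// -(sqrnormE (a - b)) expr2.
  by rewrite -[leRHS]mul1r ler_pM// ler_norml; lra.
by rewrite normrM mulrC ler_wpM2r// CP'.
Qed.

Lemma derivn_exp_factor (R : comNzRingType) (P : {poly R}) j n :
  exists Q, (P ^+ (n + j))^`(j) = P ^+ n * Q.
Proof.
elim: j n => [|j IH] n; first by exists 1; rewrite derivn0 addn0 mulr1.
have [Q EQ] := IH n.+1; exists (P^`() * Q *+ n.+1 + P * Q^`()).
rewrite derivnS -addSnnS EQ derivM deriv_exp /= mulrDr mulrnAl mulrnAr exprSr.
by rewrite !mulrA (mulrC P^`()).
Qed.

(** A polynomial that vanishes at both ends of [[0, 1]] is extended by zero when
    composed with this 1-Lipschitz projection, which transfers its estimates from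
    [[0, 1]] to the line. *)
Definition clamp (R : realFieldType) (t : R) := Num.max 0 (Num.min t 1).

Variant clamp_spec (R : realFieldType) (t : R) : R -> Prop :=
| ClampLt of t < 0 : clamp_spec t 0
| ClampIn of 0 <= t <= 1 : clamp_spec t t
| ClampGt of 1 < t : clamp_spec t 1.

Lemma clampP (R : realFieldType) (t : R) : clamp_spec t (clamp t).
Proof.
rewrite /clamp; case: (ltP t 1) => [t1|]; last first.
  rewrite max_r ?ler01// le_eqVlt => /predU1P[<-|t1]; last exact: ClampGt.
  by apply: ClampIn; rewrite ler01 lexx.
case: (leP 0 t) => t0; last exact: ClampLt.
by apply: ClampIn; rewrite t0 ltW.
Qed.

Section Clamped.
Context {R : realFieldType}.
Implicit Types (P : {poly R}) (t s C : R).

Lemma clamp01 t : 0 <= clamp t <= 1.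
Proof. by case: (clampP t) => //; rewrite ?lexx ?ler01. Qed.

Lemma clamp_lip s t : `|clamp s - clamp t| <= `|s - t|.
Proof.
wlog st : s t / s <= t.
  by move=> H; case/orP: (le_total s t) => /H//; rewrite distrC (distrC t).
rewrite distrC (distrC s) [leRHS]ger0_norm ?subr_ge0//.
by rewrite ler_norml; case: (clampP s) => hs; case: (clampP t) => ht; lra.
Qed.

(** Outside [[0, 1]] the clamped argument stops moving, so the linear term must be
    controlled separately: it is zero when [t] is outside, and when [t] is inside
    and [t + s] is not, [P'] is small at [t] because [t] is within [|s|] of an
    endpoint, where [P'] vanishes. *)
Lemma clamp_taylor P C : 0 <= C ->
  P^`().[0] = 0 -> P^`().[1] = 0 ->
  (forall a b, 0 <= a <= 1 -> 0 <= b <= 1 ->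
    `|P.[a] - P.[b] - (a - b) * P^`().[b]| <= C * (a - b) ^+ 2) ->
  (forall a b, 0 <= a <= 1 -> 0 <= b <= 1 ->
    `|P^`().[a] - P^`().[b]| <= C * `|a - b|) ->
  forall t s, `|P.[clamp (t + s)] - P.[clamp t] - s * P^`().[clamp t]|
    <= (C + C) * s ^+ 2.
Proof.
move=> C0 P0 P1 PT PL t s.
have -> : P.[clamp (t + s)] - P.[clamp t] - s * P^`().[clamp t] =
  (P.[clamp (t + s)] - P.[clamp t]
    - (clamp (t + s) - clamp t) * P^`().[clamp t])
  + (clamp (t + s) - clamp t - s) * P^`().[clamp t] by ring.
have hs : `|clamp (t + s) - clamp t| <= `|s|.
  by rewrite (le_trans (clamp_lip _ _))// addrAC subrr add0r.
rewrite (le_trans (ler_normD _ _))// [leRHS]mulrDl lerD//.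
  rewrite (le_trans (PT _ _ (clamp01 _) (clamp01 _)))// ler_wpM2l//.
  by rewrite -(sqrnormE (_ - _)) -(sqrnormE s) lerXn2r ?nnegrE.
case: (clampP t) => ht; rewrite ?P0 ?P1 ?mulr0 ?normr0 ?(mulr_ge0 C0 (sqr_ge0 _))//.
case: (clampP (t + s)) => hts.
- rewrite normrM -(sqrnormE s) expr2 mulrCA ler_pM//.
    by rewrite ger0_norm ?ler0_norm; lra.
  rewrite -[leLHS]normrN -[- _]add0r -P0; case/andP: ht => t0 t1.
  rewrite (le_trans (PL _ _ _ _)) ?lexx ?ler01 ?t0//.
  by rewrite ler_wpM2l// sub0r normrN (ger0_norm t0) ler0_norm; lra.
- by rewrite (_ : t + s - t - s = 0) ?mul0r ?normr0 ?(mulr_ge0 C0 (sqr_ge0 _))//;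
  ring.
- rewrite normrM -(sqrnormE s) expr2 mulrCA ler_pM//.
    by rewrite ler0_norm ?ger0_norm; lra.
  rewrite -[leLHS]normrN -[- _]add0r -P1; case/andP: ht => t0 t1.
  rewrite (le_trans (PL _ _ _ _)) ?lexx ?ler01 ?t0//.
  by rewrite ler_wpM2l// ger0_norm ?ger0_norm; lra.
Qed.

End Clamped.

(** [psi j] stands for the [j]-th derivative of a bump [psi 0] supported in
    [[0, 1]].  Differentiability is replaced by a Taylor estimate with an explicit
    constant, normalised to 1, because such estimates pass to products and sums
    by elementary algebra. *)
Record profile (R : realFieldType) (k : nat) (psi : nat -> R -> R) (kappa : R)
    : Prop := {
  profile_le1 : forall j t, (j <= k)%N -> `|psi j t| <= 1;
  profile_lip : forall j s t, (j <= k)%N -> `|psi j s - psi j t| <= `|s - t|;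
  profile_taylor : forall j t s, (j < k)%N ->
    `|psi j (t + s) - psi j t - s * psi j.+1 t| <= s ^+ 2;
  profile_supp : forall j t, (j <= k)%N -> psi j t != 0 -> 0 < t < 1;
  profile_gt0 : 0 < kappa;
  profile_ge : forall t, 4^-1 <= t <= 3 / 4 -> kappa <= psi 0%N t }.

(** The bump is [(t (1 - t))^(k+2)], extended by zero and divided by a constant that
    dominates all the bounds; its derivatives up to order [k + 1] vanish at both
    endpoints. *)
Lemma profile_exists (R : realType) (k : nat) :
  exists psi kappa, @profile R k psi kappa.
Proof.
pose P : {poly R} := 'X * (1 - 'X); pose Q := P ^+ k.+2.
have Q01 j : (j <= k.+1)%N -> Q^`(j).[0] = 0 /\ Q^`(j).[1] = 0.
  move=> jk; rewrite /Q.
  have [S] := derivn_exp_factor P j (k.+1 - j).+1.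
  rewrite addSn subnK// => ->; rewrite exprS -mulrA !hornerM hornerX.
  by rewrite !(hornerD, hornerN, hornerC, hornerX) subrr !(mul0r, mulr0).
have /choice[C HC] : forall j, exists C, 0 <= C /\
    [/\ forall a, 0 <= a <= 1 -> `|Q^`(j).[a]| <= C,
        forall a b, 0 <= a <= 1 -> 0 <= b <= 1 ->
          `|Q^`(j).[a] - Q^`(j).[b]| <= C * `|a - b| &
        forall a b, 0 <= a <= 1 -> 0 <= b <= 1 ->
          `|Q^`(j).[a] - Q^`(j).[b] - (a - b) * Q^`(j.+1).[b]|
            <= C * (a - b) ^+ 2].
  move=> j; have [C1 [C10 H1]] := poly_bounded Q^`(j).
  have [C2 [C20 H2]] := poly_lip Q^`(j).
  have [C3 [C30 H3]] := poly_taylor Q^`(j).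
  exists (C1 + C2 + C3); split; first by rewrite !addr_ge0.
  split=> [a a01|a b a01 b01|a b a01 b01].
  - by rewrite (le_trans (H1 _ a01))// -addrA lerDl addr_ge0.
  - rewrite (le_trans (H2 _ _ a01 b01))// ler_wpM2r//; lra.
  - rewrite derivnS (le_trans (H3 _ _ a01 b01))// ler_wpM2r ?sqr_ge0//; lra.
pose D := \sum_(j < k.+2) C j; pose M := D + D + 1.
have CD j : (j <= k.+1)%N -> C j <= D.
  move=> jk; rewrite /D (bigD1 (Ordinal (jk : (j < k.+2)%N)))//= lerDl sumr_ge0//.
  by move=> i _; case: (HC i).
have D0 : 0 <= D by rewrite sumr_ge0// => i _; case: (HC i).
have M0 : 0 < M by rewrite /M; lra.
pose psi j t := M^-1 * Q^`(j).[clamp t].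
have scale x y : `|x| <= M * y -> `|M^-1 * x| <= y.
  by move=> h; rewrite normrM normfV (gtr0_norm M0) mulrC ler_pdivrMr// mulrC.
exists psi, (M^-1 * (3 / 16) ^+ k.+2); split.
- move=> j t jk; apply: scale; have [_ [H _ _]] := HC j.
  by apply: le_trans (H _ (clamp01 t)) _; have := CD j (leqW jk); rewrite /M; lra.
- move=> j s t jk; rewrite /psi -mulrBr; apply: scale; have [_ [_ H _]] := HC j.
  rewrite (le_trans (H _ _ (clamp01 s) (clamp01 t)))// ler_pM ?clamp_lip//.
    by case: (HC j).
  by have := CD j (leqW jk); rewrite /M; lra.
- move=> j t s jk; rewrite /psi mulrCA -!mulrBr; apply: scale; rewrite derivnS.
  have [_ [_ _ H]] := HC j; have [_ [_ H' _]] := HC j.+1.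
  have [q0 q1] := Q01 j.+1 (leqW jk).
  apply: le_trans (clamp_taylor D0 q0 q1 _ _ t s) _.
  + move=> a b a01 b01; rewrite (le_trans (H _ _ a01 b01))//.
    by rewrite ler_wpM2r ?sqr_ge0// CD// leqW// ltnW.
  + move=> a b a01 b01; rewrite (le_trans (H' _ _ a01 b01))//.
    by rewrite ler_wpM2r// CD// leqW.
  + by rewrite ler_wpM2r ?sqr_ge0// /M; lra.
- move=> j t jk; rewrite mulf_eq0 invr_eq0 gt_eqF//=; apply: contraNT => ht.
  have [q0 q1] := Q01 j (leqW jk); case: (clampP t) ht => [| |]; rewrite ?q0 ?q1//.
  case/andP => t0 t1; rewrite negb_and -!leNgt => /orP[h|h].
    by rewrite (_ : t = 0) ?q0//; lra.
  by rewrite (_ : t = 1) ?q1//; lra.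
- by rewrite mulr_gt0 ?invr_gt0// exprn_gt0//; lra.
- move=> t ht; rewrite /psi derivn0 ler_pM2l ?invr_gt0//.
  case: (clampP t); [lra| |lra].
  move=> _; rewrite /Q horner_exp lerXn2r ?nnegrE ?hornerM ?hornerD ?hornerN
    ?hornerX ?hornerC; nra.
Qed.

(** * Inner products and contraction of jets against directions *)

Section Inner.
Context {R : realType} {X : hilbertType R}.
Implicit Types (x y z : X).

Lemma innerP a x y z : inner (a *: x + y) z = a * inner x z + inner y z.
Proof. by rewrite innerD innerZ. Qed.

Lemma innerB x y z : inner (x - y) z = inner x z - inner y z.
Proof. by rewrite -scaleN1r addrC innerP mulN1r addrC. Qed.

Lemma inner0 z : inner (0 : X) z = 0.
Proof. by rewrite -(subrr (0 : X)) innerB subrr. Qed.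

Lemma innerZr a x y : inner x (a *: y) = a * inner x y.
Proof. by rewrite innerC innerZ innerC. Qed.

(** Cauchy-Schwarz, from the nonnegativity of the square of
    [|y|^2 x - <x, y> y]. *)
Lemma inner_le x y : `|inner x y| <= `|x| * `|y|.
Proof.
have [->|y0] := eqVneq y 0.
  by rewrite innerC inner0 normr0 mulr_ge0.
have yy : 0 < `|y| by rewrite normr_gt0.
have : 0 <= inner (`|y| ^+ 2 *: x - inner x y *: y) (`|y| ^+ 2 *: x - inner x y *: y).
  by rewrite inner_norm sqr_ge0.
rewrite innerB !innerZ !(innerC _ (_ - _)) !innerB !innerZ !inner_norm (innerC y x).
set s := inner x y => H.
have : 0 <= `|y| ^+ 2 * (`|x| ^+ 2 * `|y| ^+ 2 - s ^+ 2) by nra.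
rewrite pmulr_rge0 ?exprn_gt0// subr_ge0 -(sqrnormE s) -exprMn.
by rewrite ler_sqr ?nnegrE ?mulr_ge0.
Qed.

Lemma inner_continuous z : continuous (fun x => inner x z : R).
Proof.
move=> x; apply/cvgrPdist_le => e e0.
have c0 : 0 < `|z| + 1 by rewrite ltr_wpDl.
near=> y; rewrite -innerB (le_trans (inner_le _ _))//.
rewrite (@le_trans _ _ (e / (`|z| + 1) * (`|z| + 1)))//; last by rewrite divfK ?gt_eqF.
rewrite ler_pM ?lerDl//.
by near: y; apply: cvgr_dist_le => //; rewrite divr_gt0.
Unshelve. all: by end_near. Qed.

End Inner.

Lemma continuous_sum (R : realType) (T : topologicalType) (I : Type) (r : seq I)
    (f : I -> T -> R) : (forall i, continuous (f i)) ->
  continuous (fun t => \sum_(i <- r) f i t).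
Proof.
move=> fc t; elim: r => [|i r IH].
  by under eq_fun do rewrite big_nil; exact: cvg_cst.
by under eq_fun do rewrite big_cons; apply: cvgD => //; exact: fc.
Qed.

Section Contract.
Context {R : realType} {X : hilbertType R} (d : nat) (e : 'I_d -> X).

(** A jet assigns to each word [w] over ['I_d] the iterated partial derivative
    along [w] of a function of the [d] linear forms [<., e i>].  Contracting it
    against vectors [v] is the chain rule: it gives the value at [v] of the
    derivative of order [j] of that function.  The recursion consumes the first
    direction first, in agreement with [cons_dir], so that differentiating once
    more amounts to replacing [g] by [fun w => g (i :: w)]. *)
Fixpoint contract_jet j (g : seq 'I_d -> R) : ('I_j -> X) -> R :=
  match j with
  | 0 => fun=> g [::]
  | j'.+1 => fun v => \sum_(i < d) inner (v ord0) (e i) *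
      contract_jet (fun w => g (i :: w)) (fun l : 'I_j' => v (lift ord0 l))
  end.

Lemma contract_jetB j g g' (v : 'I_j -> X) :
  contract_jet (fun w => g w - g' w) v = contract_jet g v - contract_jet g' v.
Proof.
elim: j g g' v => //= j IH g g' v; rewrite -sumrB.
by apply: eq_bigr => i _; rewrite IH mulrBr.
Qed.

Lemma contract_jet_sum j (I : finType) (c : I -> R) (g : I -> seq 'I_d -> R)
    (v : 'I_j -> X) :
  contract_jet (fun w => \sum_i c i * g i w) v = \sum_i c i * contract_jet (g i) v.
Proof.
elim: j g v => //= j IH g v.
under [RHS]eq_bigr do rewrite mulr_sumr.
rewrite exchange_big/=; apply: eq_bigr => i _.
rewrite (IH (fun l w => g l (i :: w))) mulr_sumr; apply: eq_bigr => l _.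
by rewrite mulrCA.
Qed.

(** Each slot contributes [d] terms, each of them bounded by [K]. *)
Lemma contract_jet_bound j g b K (v : 'I_j -> X) : 0 <= b -> 0 <= K ->
  (forall i, `|e i| <= K) ->
  (forall w, size w = j -> `|g w| <= b) -> (forall l, `|v l| <= 1) ->
  `|contract_jet g v| <= (d%:R * K) ^+ j * b.
Proof.
move=> b0 K0 eK; elim: j g v => /= [|j IH] g v gb v1.
  by rewrite expr0 mul1r gb.
rewrite (le_trans (ler_norm_sum _ _ _))//.
rewrite (@le_trans _ _ (\sum_(i < d) K * ((d%:R * K) ^+ j * b)))//.
  apply: ler_sum => i _; rewrite normrM ler_pM//; last first.
    by apply: IH => [w wj|l]; [rewrite gb//= wj|exact: v1].
  by rewrite (le_trans (inner_le _ _))// -[leRHS]mul1r ler_pM.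
by rewrite sumr_const card_ord exprS -!mulrA -[leLHS]mulr_natl.
Qed.

Lemma contract_jet_linear j g (v : 'I_j -> X) i a x y :
  contract_jet g (dfwith v i (a *: x + y)) =
  a * contract_jet g (dfwith v i x) + contract_jet g (dfwith v i y).
Proof.
elim: j g v i => [|j IH] g v i; first by case: i.
rewrite /= mulr_sumr -big_split/=; apply: eq_bigr => c _.
have [i0|[i' i'i]] : i = ord0 \/ exists i', i = lift ord0 i'.
  by case: (unliftP ord0 i) => [i' ->|->]; [right; exists i'|left].
- have tl z : (fun l : 'I_j => dfwith v i z (lift ord0 l)) =
              (fun l => v (lift ord0 l)).
    by apply/funext => l; rewrite dfwithout// i0 neq_lift.
  have hd z : dfwith v i z ord0 = z by rewrite -i0 dfwithin.
  by rewrite !tl !hd innerP mulrDl mulrA.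
- have tl z : (fun l : 'I_j => dfwith v i z (lift ord0 l)) =
              dfwith (fun l => v (lift ord0 l)) i' z.
    apply/funext => l; rewrite i'i; have [<-|ne] := eqVneq i' l; first by rewrite !dfwithin.
    by rewrite !dfwithout// (inj_eq lift_inj).
  have hd z : dfwith v i z ord0 = v ord0.
    by rewrite dfwithout// i'i eq_sym neq_lift.
  by rewrite !tl !hd IH mulrDr mulrCA.
Qed.

(** Continuity for the topology of pointwise convergence is obtained through an
    arbitrary parameter space [T], since this form is stable under dropping the
    first vector of [v]. *)
Lemma contract_jet_comp_continuous (T : topologicalType) j g (v : T -> 'I_j -> X) :
  (forall l, continuous (fun t => v t l)) ->
  continuous (fun t => contract_jet g (v t) : R).
Proof.
elim: j g v => [|j IH] g v vc; first by move=> t; exact: cvg_cst.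
apply: continuous_sum => i t; apply: cvgM; last by apply: IH => l; exact: vc.
apply: (@continuous_comp _ _ _ (fun t => v t ord0) (fun x => inner x (e i))).
  exact: vc.
exact: inner_continuous.
Qed.

Lemma contract_jet_continuous j g : continuous (@contract_jet j g : {ptws 'I_j -> X} -> R).
Proof. by apply: contract_jet_comp_continuous => l; exact: proj_continuous. Qed.

End Contract.

(** * From estimates on a jet to membership in the Hoelder ball *)

Section Opnorm.
Context {R : realType} {X Y : normedModType R} (j : nat).
Implicit Type T : ('I_j -> X) -> Y.

Lemma opnorm_le T (c : R) :
  (forall v, (forall i, `|v i| <= 1) -> `|T v| <= c) -> (opnorm T <= c%:E)%E.
Proof. by move=> H; apply: ge_ereal_sup => _ [v v1 <-]; rewrite lee_fin H. Qed.

Lemma opnorm_ge0 T : (0 <= opnorm T)%E.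
Proof.
apply: (@le_trans _ _ `|T (fun=> 0)|%:E); first by rewrite lee_fin.
by apply: ereal_sup_ubound; exists (fun=> 0) => //= i; rewrite normr0.
Qed.

End Opnorm.

Section JetBall.
Context {R : realType} {X Y : hilbertType R} (d k : nat) (e : 'I_d -> X) (K L C : R).
(* [G x w] is the partial derivative along [w], at [x], of [G ^~ [::]]. *)
Variable G : X -> seq 'I_d -> R.
Hypotheses (K0 : 0 <= K) (eK : forall i, `|e i| <= K) (C0 : 0 <= C).
Hypothesis G1 : forall x w, (size w <= k)%N -> `|G x w| <= 1.
Hypothesis GL : forall x x' w, (size w <= k)%N -> `|G x w - G x' w| <= L * `|x - x'|.
Hypothesis GT : forall x h w, (size w < k)%N ->
  `|G (x + h) w - G x w - \sum_i inner h (e i) * G x (i :: w)| <= C * `|h| ^+ 2.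

(** By linearity of the contraction in the jet, the remainder of the derivative of
    order [j] is the contraction of the remainders of the partial derivatives. *)
Lemma contract_jet_frechet j x h (v : 'I_j -> X) : (j < k)%N ->
  (forall l, `|v l| <= 1) ->
  `|contract_jet e (G (x + h)) v - contract_jet e (G x) v
    - contract_jet e (G x) (cons_dir h v)| <= (d%:R * K) ^+ j * (C * `|h| ^+ 2).
Proof.
move=> jk v1; have -> : contract_jet e (G x) (cons_dir h v) =
    contract_jet e (fun w => \sum_i inner h (e i) * G x (i :: w)) v.
  rewrite (contract_jet_sum e (fun i => inner h (e i)) (fun i w => G x (i :: w))).
  rewrite /=; apply: eq_bigr => i _; rewrite /cons_dir unlift_none/=.
  congr (_ * contract_jet _ _ _); apply/funext => l; by rewrite liftK.
rewrite -!contract_jetB; apply: contract_jet_bound => //.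
  by rewrite mulr_ge0// sqr_ge0.
by move=> w wj; apply: GT; rewrite wj.
Qed.

(** The derivatives are the contractions of [G].  For the Hoelder quotient, the
    Lipschitz bound serves when the points are at distance at most 1 and the
    uniform bound otherwise. *)
Lemma jet_C_ball (alpha b B : R) (y : Y) : 0 < alpha -> alpha <= 1 ->
  `|y| = 1 -> 0 <= b -> 2 <= L -> 1 <= d%:R * K ->
  b * (d%:R * K) ^+ k * (k.+1%:R + L) <= B ->
  C_ball k alpha B (fun x => (b * G x [::]) *: y).
Proof.
move=> a0 a1 y1 b0 L2 dK1 bB.
pose D j x (v : 'I_j -> X) : Y := (b * contract_jet e (G x) v) *: y.
have D0 : 0 <= d%:R * K by rewrite (le_trans _ dK1).
have normD (t : R) : `|t *: y| = `|t| by rewrite normrZ y1 mulr1.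
exists D; split; first split.
- by [].
- move=> j x jk; split.
  + move=> v i a z z'; rewrite /D contract_jet_linear mulrDr scalerDl.
    by rewrite scalerA mulrCA.
  + move=> v; rewrite (_ : D j x = (fun t => t *: (b *: y)) \o @contract_jet _ _ _ e j (G x)).
      apply: (@continuous_comp {ptws 'I_j -> X} R Y); last exact: scalel_continuous.
      exact: contract_jet_continuous.
    by apply/funext => u; rewrite /D /= scalerA mulrC.
- move=> j x jk.
  pose M := b * (d%:R * K) ^+ j * C.
  apply: (@squeeze_cvge _ _ _ _ (cst 0%E) _ (fun h : X => (M * `|h|)%:E)).
  + near=> h; have h0 : h != 0 by near: h; exact: nbhs_dnbhs_neq.
    apply/andP; split.
      by rewrite mule_ge0 ?opnorm_ge0// lee_fin invr_ge0.
    have hp : 0 < `|h| by rewrite normr_gt0.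
    rewrite (_ : (M * `|h|)%:E = (M * `|h| ^+ 2)%:E * (`|h|^-1)%:E)%E; last first.
      by rewrite -EFinM expr2 mulrA mulfK ?gt_eqF.
    apply: lee_wpmul2r; first by rewrite lee_fin invr_ge0.
    apply: opnorm_le => v v1; rewrite /D -!scalerBl normD -!mulrBr normrM.
    rewrite ger0_norm// /M -!mulrA ler_wpM2l//.
    exact: contract_jet_frechet.
  + exact: cvg_cst.
  + apply: cvg_EFin; first exact: nearW.
    rewrite -(mulr0 M) -(@normr0 _ X); apply: cvgM; first exact: cvg_cst.
    apply: cvg_within_filter; exact: norm_continuous.
have Dk j : (j <= k)%N -> (d%:R * K) ^+ j <= (d%:R * K) ^+ k.
  by move=> jk; exact: ler_weXn2l.
have Dj j x (v : 'I_j -> X) : (j <= k)%N -> (forall i, `|v i| <= 1) ->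
    `|contract_jet e (G x) v| <= (d%:R * K) ^+ k :> R.
  move=> jk v1; have gb w : size w = j -> `|G x w| <= 1.
    by move=> wj; rewrite G1// wj.
  by rewrite (le_trans (contract_jet_bound ler01 K0 eK gb v1))// mulr1 Dk.
apply: le_trans (_ : (b * (d%:R * K) ^+ k * (k.+1%:R + L))%:E <= _)%E; last first.
  by rewrite lee_fin.
rewrite mulrDr EFinD; apply: leeD.
  rewrite (_ : (_ * _)%:E = (\sum_(j < k.+1) (b * (d%:R * K) ^+ k)%:E)%E); last first.
    by rewrite sumEFin sumr_const card_ord mulr_natr.
  apply: lee_sum => j _; apply: ge_ereal_sup => _ [x _ <-].
  apply: opnorm_le => v v1; rewrite normD normrM (ger0_norm b0) ler_wpM2l//.
  by apply: Dj => //; rewrite -ltnS.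
apply: ge_ereal_sup => _ [x [x' [xx' ->]]].
have xx0 : 0 < `|x - x'| by rewrite normr_gt0 subr_eq0.
have pp : 0 < `|x - x'| `^ alpha by exact: powR_gt0.
rewrite (_ : (_ * L)%:E =
  (b * (d%:R * K) ^+ k * L * `|x - x'| `^ alpha)%:E * (`|x - x'| `^ alpha)^-1%:E)%E;
  last by rewrite -EFinM mulfK ?gt_eqF.
apply: lee_wpmul2r; first by rewrite lee_fin invr_ge0 ltW.
apply: opnorm_le => v v1; rewrite /D -scalerBl normD -mulrBr normrM (ger0_norm b0).
rewrite -!mulrA ler_wpM2l//; have [x1|x1] := leP `|x - x'| 1.
- rewrite -contract_jetB (@le_trans _ _ ((d%:R * K) ^+ k * (L * `|x - x'|)))//.
    apply: contract_jet_bound => //; first by rewrite mulr_ge0// (le_trans _ L2).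
    by move=> w wk; apply: GL; rewrite wk.
  rewrite ler_wpM2l ?exprn_ge0// ler_wpM2l ?(le_trans _ L2)//.
  by rewrite -{1}(powRr1 (ltW xx0)) ger_powR// xx0.
- have x1a : 1 <= `|x - x'| `^ alpha.
    by rewrite -(powRr0 `|x - x'|) ler_powR ?ltW.
  rewrite (le_trans (ler_normB _ _))// (@le_trans _ _ ((d%:R * K) ^+ k * 2))//.
    by rewrite mulr_natr mulr2n lerD// Dj.
  by rewrite ler_wpM2l ?exprn_ge0// -[2]mulr1 ler_pM.
Unshelve. all: by end_near. Qed.

End JetBall.

(** * Signed sums of product bumps over a grid of cells *)

Section ProductEstimates.
Context {R : realFieldType} {I : eqType}.
Implicit Types (r : seq I) (a b l : I -> R) (delta eps : R).

Lemma prod_le1 r a : (forall i, `|a i| <= 1) -> `|\prod_(i <- r) a i| <= 1.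
Proof.
move=> a1; elim: r => [|i r IH]; first by rewrite big_nil normr1.
by rewrite big_cons normrM -[leRHS]mulr1 ler_pM.
Qed.

Lemma prod_lip r a b delta : (forall i, `|a i| <= 1) -> (forall i, `|b i| <= 1) ->
  (forall i, `|b i - a i| <= delta) ->
  `|\prod_(i <- r) b i - \prod_(i <- r) a i| <= (size r)%:R * delta.
Proof.
move=> a1 b1 ab; elim: r => [|i r IH].
  by rewrite !big_nil subrr normr0 mul0r.
rewrite !big_cons; set A := \prod_(i <- r) a i; set B := \prod_(i <- r) b i.
have -> : b i * B - a i * A = b i * (B - A) + (b i - a i) * A by ring.
rewrite (le_trans (ler_normD _ _))// /= -natr1 [leRHS]mulrDl mul1r lerD// normrM.
  by rewrite -[leRHS]mul1r ler_pM// b1.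
by rewrite -[leRHS]mulr1 ler_pM// prod_le1.
Qed.

(** Here [a] and [b] are the values of the factors at two points and [l] their
    linearisations; the second sum is the Leibniz rule.  Per additional factor the
    error grows by [eps] and by one product of two increments. *)
Lemma prod_taylor r a b l delta eps : uniq r ->
  (forall i, `|a i| <= 1) -> (forall i, `|b i| <= 1) ->
  (forall i, `|b i - a i| <= delta) ->
  (forall i, `|b i - a i - l i| <= eps) ->
  `|\prod_(i <- r) b i - \prod_(i <- r) a i
     - \sum_(i <- r) \prod_(j <- r) (if j == i then l j else a j)|
    <= (size r)%:R * eps + (size r)%:R ^+ 2 * delta ^+ 2.
Proof.
move=> + a1 b1 ab abl; elim: r => [_|i r IH /= /andP[ir ur]].
  by rewrite !big_nil subrr subr0 normr0 !mul0r expr0n mul0r addr0.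
have d0 : 0 <= delta := le_trans (normr_ge0 _) (ab i).
rewrite !big_cons eqxx.
rewrite (_ : \prod_(j <- r) (if j == i then l j else a j) = \prod_(j <- r) a j);
  last by apply: eq_big_seq => j jr; case: eqP => // ji; rewrite -ji jr in ir.
rewrite (_ : \sum_(m <- r) _ =
  a i * \sum_(m <- r) \prod_(j <- r) (if j == m then l j else a j)); last first.
  rewrite mulr_sumr; apply: eq_big_seq => m mr; rewrite big_cons ifN//.
  by apply: contraNneq ir => ->.
have := IH ur; have := prod_lip r a1 b1 ab; have := prod_le1 r a1.
set A := \prod_(i <- r) a i; set B := \prod_(i <- r) b i.
set L := \sum_(i <- r) _ => A1 AB ABL.
have -> : b i * B - a i * A - (l i * A + a i * L) =
  (b i - a i - l i) * A + a i * (B - A - L) + (b i - a i) * (B - A) by ring.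
have H1 : `|(b i - a i - l i) * A| <= eps by rewrite normrM -[eps]mulr1 ler_pM.
have H2 : `|a i * (B - A - L)| <=
    (size r)%:R * eps + (size r)%:R ^+ 2 * delta ^+ 2.
  by rewrite normrM -[leRHS]mul1r ler_pM.
have H3 : `|(b i - a i) * (B - A)| <= delta * ((size r)%:R * delta).
  by rewrite normrM ler_pM.
have n0 : 0 <= (size r)%:R :> R by [].
rewrite (le_trans (ler_normD _ _))// (le_trans (lerD (ler_normD _ _) (lexx _)))//.
rewrite -natr1 (le_trans (lerD (lerD H1 H2) H3))//.
have := mulr_ge0 n0 (sqr_ge0 delta); have := sqr_ge0 delta; nra.
Qed.

End ProductEstimates.

Section BumpSums.
Context {R : realType} {X : hilbertType R} (d N k : nat) (e : 'I_d -> X) (K : R).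
Variables (psi : nat -> R -> R) (kappa : R).
Hypotheses (pr : profile k psi kappa) (K0 : 0 <= K) (eK : forall i, `|e i| <= K).

Local Notation cell := {ffun 'I_d -> 'I_N}.

(** [cell_bump c x w] is the partial derivative along [w] of the product bump of the
    cell [c]: the factor in the [i]-th coordinate has been differentiated as many
    times as [i] occurs in [w]. *)
Definition cell_bump (c : cell) (x : X) (w : seq 'I_d) : R :=
  \prod_i psi (count_mem i w) (inner x (e i) - (c i)%:R).

Definition bump_sum (tau : {ffun cell -> bool}) (x : X) (w : seq 'I_d) : R :=
  \sum_c (-1) ^+ tau c * cell_bump c x w.

Lemma bump_supp c x w i : (size w <= k)%N -> cell_bump c x w != 0 ->
  0 < inner x (e i) - (c i)%:R < 1.
Proof.
move=> wk /prodf_neq0/(_ i isT); apply: (profile_supp pr).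
exact: leq_trans (count_size _ _) wk.
Qed.

(** The open unit cubes with corners [c] are disjoint. *)
Lemma bump_neq0_inj c c' x w w' : (size w <= k)%N -> (size w' <= k)%N ->
  cell_bump c x w != 0 -> cell_bump c' x w' != 0 -> c = c'.
Proof.
move=> wk wk' b0 b0'; apply/ffunP => i; apply/val_inj => /=.
have := bump_supp i wk b0; have := bump_supp i wk' b0'.
case/andP=> h1 h2 /andP[h3 h4].
have lt (m n : nat) (t : R) : 0 < t - m%:R -> t - n%:R < 1 -> (m <= n)%N.
  by move=> tm tn; rewrite -ltnS -(ltr_nat R) -natr1; lra.
by apply/eqP; rewrite eqn_leq (lt _ _ _ h3 h2) (lt _ _ _ h1 h4).
Qed.

(** At each point at most one bump is active.  The bounds on the values
    and on the increments of a sum over the cells reduce to this one, and so do not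
    depend on the number of cells. *)
Lemma sum_active x w : (size w <= k)%N -> \sum_c (cell_bump c x w != 0)%:R <= 1 :> R.
Proof.
move=> wk; rewrite -natr_sum (ler_nat _ _ 1).
rewrite (eq_bigr (fun c => if cell_bump c x w != 0 then 1%N else 0%N)) => [|c _];
  last by case: ifP.
rewrite -big_mkcond sum1dep_card; apply/card_le1_eqP => c c'.
by rewrite !inE => b0 b0'; exact: (bump_neq0_inj wk wk b0' b0).
Qed.

Lemma bump_le1 c x w : (size w <= k)%N -> `|cell_bump c x w| <= 1.
Proof.
move=> wk; apply: prod_le1 => i; apply: (profile_le1 pr).
exact: leq_trans (count_size _ _) wk.
Qed.

Lemma inner_lip (h : X) i : `|inner h (e i)| <= K * `|h|.
Proof. by rewrite (le_trans (inner_le _ _))// mulrC ler_wpM2r. Qed.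

Lemma bump_lip c x x' w : (size w <= k)%N ->
  `|cell_bump c x w - cell_bump c x' w| <= d%:R * (K * `|x - x'|).
Proof.
move=> wk; have cw i : (count_mem i w <= k)%N := leq_trans (count_size _ _) wk.
have := @prod_lip R _ (index_enum 'I_d)
  (fun i => psi (count_mem i w) (inner x' (e i) - (c i)%:R))
  (fun i => psi (count_mem i w) (inner x (e i) - (c i)%:R)) (K * `|x - x'|).
have -> : size (index_enum 'I_d) = d by rewrite -sum1_size sum1_card card_ord.
apply=> i; [exact: (profile_le1 pr)|exact: (profile_le1 pr)|].
rewrite (le_trans (profile_lip pr _ _ (cw i)))//.
by rewrite opprD opprK addrACA addNr addr0 -innerB inner_lip.
Qed.

Lemma bump_taylor c x h w : (size w < k)%N ->
  `|cell_bump c (x + h) w - cell_bump c x w - \sum_i inner h (e i) * cell_bump c x (i :: w)|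
   <= (d%:R + d%:R ^+ 2) * K ^+ 2 * `|h| ^+ 2.
Proof.
move=> wk; have cw i : (count_mem i w < k)%N := leq_ltn_trans (count_size _ _) wk.
pose t i := inner x (e i) - (c i)%:R.
have tD i : inner (x + h) (e i) - (c i)%:R = t i + inner h (e i).
  by rewrite innerD addrAC.
have := @prod_taylor R _ (index_enum 'I_d)
  (fun i => psi (count_mem i w) (t i))
  (fun i => psi (count_mem i w) (t i + inner h (e i)))
  (fun i => inner h (e i) * psi (count_mem i w).+1 (t i))
  (K * `|h|) (K ^+ 2 * `|h| ^+ 2) (index_enum_uniq _).
have -> : size (index_enum 'I_d) = d by rewrite -sum1_size sum1_card card_ord.
rewrite exprMn -mulrDl -mulrA; set S := \sum_(i <- _) _.
have -> : S = \sum_i inner h (e i) * cell_bump c x (i :: w).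
  apply: eq_bigr => i _; rewrite (bigD1 i)//= eqxx /cell_bump [in RHS](bigD1 i)//=.
  rewrite eqxx add1n mulrA; congr (_ * _); apply: eq_bigr => l li.
  by rewrite (negPf li) eq_sym (negPf li) add0n.
rewrite /cell_bump; under [in X in _ -> X]eq_bigr do rewrite tD.
apply => i.
- exact: (profile_le1 pr _ (ltnW (cw i))).
- exact: (profile_le1 pr _ (ltnW (cw i))).
- rewrite (le_trans (profile_lip pr _ _ (ltnW (cw i))))//.
  by rewrite addrAC subrr add0r inner_lip.
- rewrite (le_trans (profile_taylor pr _ _ (cw i)))//.
  by rewrite -exprMn -(sqrnormE (inner _ _)) lerXn2r ?nnegrE ?mulr_ge0 ?inner_lip.
Qed.

Lemma bump_sum_le1 tau x w : (size w <= k)%N -> `|bump_sum tau x w| <= 1.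
Proof.
move=> wk; rewrite (le_trans (ler_norm_sum _ _ _))// (le_trans _ (sum_active x wk))//.
apply: ler_sum => c _; rewrite normrM normrX normrN1 expr1n mul1r.
by have [->|_] := eqVneq; [rewrite normr0|exact: bump_le1].
Qed.

(** A bump contributes to the difference only if it is active at [x] or at [x'],
    hence at most two bumps do. *)
Lemma bump_sum_lip tau x x' w : (size w <= k)%N ->
  `|bump_sum tau x w - bump_sum tau x' w| <= 2 * (d%:R * K) * `|x - x'|.
Proof.
move=> wk; rewrite -sumrB (le_trans (ler_norm_sum _ _ _))//.
pose D := d%:R * (K * `|x - x'|).
have D0 : 0 <= D by rewrite !mulr_ge0.
apply: le_trans (_ : \sum_c ((cell_bump c x w != 0)%:R + (cell_bump c x' w != 0)%:R) * D <= _).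
  apply: ler_sum => c _; rewrite -mulrBr normrM normrX normrN1 expr1n mul1r.
  have := bump_lip c x x' wk; rewrite -/D.
  have [->|_] := eqVneq (cell_bump c x w); last first.
    by move/le_trans; apply; rewrite -[leLHS]mul1r ler_wpM2r// lerDl.
  have [->|_] := eqVneq (cell_bump c x' w); last by rewrite /= mulr0n !add0r mulr1n mul1r.
  by rewrite subrr normr0 /= mulr0n !addr0 mul0r.
rewrite -mulr_suml big_split/= -mulrA -mulrA -/D ler_wpM2r//.
by rewrite -[2]/(1 + 1) lerD// sum_active.
Qed.

Lemma bump_sum_continuous tau w : (size w <= k)%N ->
  continuous (fun x => bump_sum tau x w : R).
Proof.
move=> wk x; apply/cvgrPdist_le => eps eps0.
have c0 : 0 < 2 * (d%:R * K) + 1 by rewrite ltr_wpDl// !mulr_ge0.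
near=> x'; rewrite (le_trans (bump_sum_lip tau x x' wk))//.
rewrite (@le_trans _ _ ((2 * (d%:R * K) + 1) * (eps / (2 * (d%:R * K) + 1))))//;
  last by rewrite mulrC divfK ?gt_eqF.
rewrite ler_pM ?lerDl ?mulr_ge0//.
by near: x'; apply: cvgr_dist_le => //; rewrite divr_gt0.
Unshelve. all: by end_near. Qed.

(** The constant may depend on the number of cells: it only witnesses
    differentiability and does not enter the Hoelder norm. *)
Lemma bump_sum_taylor tau x h w : (size w < k)%N ->
  `|bump_sum tau (x + h) w - bump_sum tau x w
      - \sum_i inner h (e i) * bump_sum tau x (i :: w)|
   <= #|{: cell}|%:R * ((d%:R + d%:R ^+ 2) * K ^+ 2) * `|h| ^+ 2.
Proof.
move=> wk; rewrite /bump_sum.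
under [X in _ - X]eq_bigr do rewrite mulr_sumr.
rewrite exchange_big/= -!sumrB (le_trans (ler_norm_sum _ _ _))//.
rewrite -mulrA mulr_natl -sumr_const; apply: ler_sum => c _.
rewrite (eq_bigr (fun i => (-1) ^+ tau c * (inner h (e i) * cell_bump c x (i :: w))));
  last by move=> i _; rewrite mulrCA.
rewrite -mulr_sumr -!mulrBr normrM normrX normrN1 expr1n mul1r.
exact: bump_taylor.
Qed.

Lemma bump_sum_C_ball (Y : hilbertType R) tau (alpha b B : R) (y : Y) :
  0 < alpha -> alpha <= 1 -> `|y| = 1 -> 0 <= b -> 1 <= d%:R * K ->
  b * (d%:R * K) ^+ k * (k.+1%:R + 2 * (d%:R * K)) <= B ->
  C_ball k alpha B (fun x => (b * bump_sum tau x [::]) *: y).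
Proof.
move=> a0 a1 y1 b0 dK bB.
apply: (jet_C_ball K0 eK _ (bump_sum_le1 tau) (bump_sum_lip tau)
  (bump_sum_taylor tau) a0 a1 y1 b0 _ dK bB).
- by rewrite !mulr_ge0// addr_ge0// sqr_ge0.
- by rewrite -[leLHS]mulr1 ler_pM.
Qed.

End BumpSums.

(** * Borel measurability in separable normed spaces *)

Section BorelMeasurability.
Context {R : realType}.

Lemma open_borel_measurable (V : normedModType R) (U : set V) :
  open U -> measurable (U : set (borel V)).
Proof. by move=> oU; apply: sub_sigma_algebra. Qed.

Lemma continuous_borel_measurable (V W : normedModType R) (f : V -> W) :
  continuous f -> measurable_fun setT (f : borel V -> borel W).
Proof.
move=> fc; apply: (@measurability _ _ (borel V) (borel W) setT f (@open W)) => // _ [U oU <-].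
by rewrite setTI; apply: open_borel_measurable; exact: open_comp.
Qed.

Lemma continuous_real_measurable (V : normedModType R) (f : V -> R) :
  continuous f -> measurable_fun setT (f : borel V -> R).
Proof.
move=> fc; apply: (@measurability _ _ (borel V) R setT f _
  (RGenOInfty.measurableE R)) => _ [_ [a ->] <-].
rewrite setTI; apply: open_borel_measurable; apply: open_comp => //.
Qed.

(** Approximating [f t] by a point [z] of a countable dense set reduces the event
    [f t + g t] in [U] to countably many conditions that involve [f] and [g]
    separately. *)
Lemma separable_measurable_add (V : normedModType R) d (T : measurableType d)
    (f g : T -> V) : separable V ->
  measurable_fun setT (f : T -> borel V) -> measurable_fun setT (g : T -> borel V) ->
  measurable_fun setT ((fun t => f t + g t) : T -> borel V).
Proof.
move=> [D cD dD] mf mg.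
apply: (@measurability _ _ T (borel V) setT _ (@open V)) => // _ [U oU <-].
rewrite setTI.
pose r (n : nat) : R := n.+1%:R^-1.
have r0 n : 0 < r n by rewrite invr_gt0.
pose W z n := ([set y | forall v, `|v - (z + y)| < r n -> U v])^°.
rewrite (_ : _ @^-1` U = \bigcup_(z in D) \bigcup_n
    ((f @^-1` ball z (r n)) `&` (g @^-1` W z n))); last first.
  apply/seteqP; split => [t /= Ut|t [z _ [n _ [fz /interior_subset gW]]]]; last first.
    apply: gW; rewrite opprD addrACA subrr addr0 distrC.
    by move: fz; rewrite -ball_normE.
  have /nbhs_ballP[s /= s0 sU] := open_nbhs_nbhs (conj oU Ut).
  have [n ns] : exists n, r n + r n + r n < s.
    have [n ns] := ltr_add_invr (y := 0) (x := s / 3) ltac:(by rewrite divr_gt0).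
    by exists n; move: ns; rewrite add0r -/(r n); lra.
  have [z [zD zf]] : exists z, D z /\ `|f t - z| < r n.
    have := dD (ball (f t) (r n)) _ _.
    case.
    - by exists (f t); exact: ballxx.
    - exact: ball_open.
    - by move=> z [/= + zD]; rewrite -ball_normE /= => zf; exists z.
  exists z => //; exists n => //; split; first by rewrite /= -ball_normE /= distrC.
  apply/nbhs_ballP; exists (r n); first exact: r0.
  move=> y; rewrite -ball_normE /= => gy v vz; apply: sU; rewrite -ball_normE /=.
  rewrite (_ : _ - v = (f t - z) + (g t - y) - (v - (z + y))); last first.
    by rewrite opprB [X in _ = X + _]addrACA -opprD addrA subrK.
  rewrite (le_lt_trans (ler_normB _ _))//.
  rewrite (le_lt_trans (lerD (ler_normD _ _) (lexx _)))//.
  by rewrite (lt_trans _ ns)// ltrD// ltrD.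
rewrite bigcup_set_type; apply: countable_bigcupT_measurable.
  by rewrite (eq_countable (card_setT _)).
move=> z; apply: bigcupT_measurable => n; apply: measurableI.
- rewrite -[X in measurable X]setTI; apply: mf => //.
  by apply: open_borel_measurable; exact: ball_open.
- rewrite -[X in measurable X]setTI; apply: mg => //.
  by apply: open_borel_measurable; exact: (@open_interior V).
Qed.

End BorelMeasurability.

(** * Lower bounds for norms, averages and probabilities *)

Section MeasureBounds.
Local Open Scope ereal_scope.

(** A Chebyshev-type bound. *)
Lemma Lnorm_ge d (T : measurableType d) (R : realType)
    (mu : {measure set T -> \bar R}) (f : T -> R) (A : set T) (t p : R) :
  (0 <= t)%R -> (0 < p)%R -> measurable_fun setT f -> measurable A ->
  (forall x, A x -> (t <= `|f x|)%R) ->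
  t%:E * (mu A `^ p^-1) <= 'N[mu]_p%:E[(fun x => (f x)%:E)].
Proof.
move=> t0 p0 mf mA tf.
have -> : t%:E * (mu A `^ p^-1) = ((t `^ p)%:E * mu A) `^ p^-1.
  rewrite poweRM ?lee_fin ?powR_ge0// poweR_EFin -powRrM mulfV ?gt_eqF//.
  by rewrite powRr1.
rewrite unlock; apply: gt0_ler_poweR.
- by rewrite invr_ge0 ltW.
- by rewrite in_itv/= leey andbT mule_ge0// lee_fin powR_ge0.
- by rewrite in_itv/= leey andbT integral_ge0// => x _; rewrite poweR_ge0.
have mfp : measurable_fun setT (fun x => `|(f x)%:E| `^ p).
  apply/measurable_EFinP/(measurableT_comp (measurable_powR _)).
  exact: measurableT_comp.
rewrite -integral_cst//; apply: (@le_trans _ _ (\int[mu]_(x in A) (`|(f x)%:E| `^ p))).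
  apply: ge0_le_integral => //.
  - by move=> x _; rewrite lee_fin powR_ge0.
  - exact: measurable_funTS.
  - move=> x Ax /=; rewrite lee_fin ge0_ler_powR ?nnegrE ?(ltW p0)//.
    exact: tf.
by apply: ge0_subset_integral => // x _; rewrite poweR_ge0.
Qed.

(** Bayes lower bound for the maximal risk.  Summing over the index [i] and over its
    partner [flip t i] counts every loss twice, whatever the permutation [flip t]
    is; this allows it to depend on the random outcome [t]. *)
Lemma flip_average d (T : measurableType d) (R : realType) (P : probability T R)
    (I : finType) (i0 : I) (f : I -> T -> \bar R) (flip : T -> I -> I)
    (c : R) (s : \bar R) :
  (forall i, measurable_fun setT (f i)) -> (forall i t, 0 <= f i t) ->
  (forall t, injective (flip t)) ->
  (forall t i, (2 * c)%:E <= f i t + f (flip t i) t) ->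
  (forall i, \int[P]_t f i t <= s) -> c%:E <= s.
Proof.
move=> mf f0 finj fc fs.
have n0 : (0 < #|I|%:R :> R)%R by rewrite ltr0n; apply/card_gt0P; exists i0.
have sum_ge t : (#|I|%:R * c)%:E <= \sum_i f i t.
  have : (2 * (#|I|%:R * c))%:E <= \sum_i f i t + \sum_i f i t.
    rewrite [X in _ <= _ + X](reindex_inj (finj t)) /= -big_split/=.
    rewrite mulrCA mulr_natl -sumr_const -sumEFin.
    by apply: lee_sum => i _; exact: fc.
  have : 0 <= \sum_i f i t by apply: sume_ge0.
  by case: (\sum_i f i t) => [r| |]//= _; rewrite ?leey// -EFinD !lee_fin; lra.
have : (#|I|%:R * c)%:E <= \sum_(i : I) s.
  apply: (@le_trans _ _ (\int[P]_t \sum_i f i t)).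
    have [c0|c0] := leP c 0%R.
      apply: (@le_trans _ _ 0); first by rewrite lee_fin mulr_ge0_le0// ltW.
      by apply: integral_ge0 => t _; exact: sume_ge0.
    rewrite -[leLHS]mule1 -(probability_setT P) -integral_cst//.
    apply: ge0_le_integral => //.
    - by move=> t _; rewrite lee_fin mulr_ge0// ltW.
    - exact: emeasurable_sum.
  by rewrite ge0_integral_sum//; apply: lee_sum => i _; exact: fs.
have s0 : 0 <= s by apply: le_trans (fs i0); exact: integral_ge0.
case: s s0 {fs} => [s| |]// _; last by rewrite leey.
by rewrite sumEFin sumr_const -[(s *+ _)%R]mulr_natl !lee_fin ler_pM2l.
Qed.

Lemma density_itv d (T : measurableType d) (R : realType) (P : probability T R)
    (xi : T -> R) (nu : R -> R) (a b l w : R) :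
  has_density P xi nu -> (0 <= b)%R ->
  (forall x, (`|x| <= a)%R -> (b <= nu x)%R) ->
  (- a <= l)%R -> (0 <= w)%R -> (l + w <= a)%R ->
  (b * w)%:E <= P (xi @^-1` `[l, (l + w)%R]).
Proof.
move=> [mnu nu0 Pnu] b0 nub al w0 lwa; rewrite Pnu//.
apply: (@le_trans _ _ (\int[lebesgue_measure]_(x in `[l, (l + w)%R]) (cst b%:E x))).
  rewrite integral_cst//= lebesgue_measure_itv/= lte_fin.
  rewrite ltrDl; case: ltP => w0'.
    by rewrite -EFinD -EFinM addrAC subrr add0r.
  by rewrite mule0 lee_fin mulr_ge0_le0.
apply: ge0_le_integral => //.
- by apply/measurable_EFinP; exact: measurable_funTS.
- move=> x /=; rewrite in_itv/= => /andP[lx xw].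
  by rewrite lee_fin nub// ler_norml (le_trans al lx) (le_trans xw lwa).
Qed.

Lemma prode_ge (R : realType) (I : Type) (r : seq I) (f : I -> \bar R) (c : R) :
  (0 <= c)%R -> (forall i, c%:E <= f i) -> (c ^+ size r)%:E <= \prod_(i <- r) f i.
Proof.
move=> c0 cf; elim: r => [|i r IH]; first by rewrite big_nil.
rewrite big_cons /= exprS EFinM lee_pmul// lee_fin// exprn_ge0//.
Qed.

Lemma independent_box d (T : measurableType d) (R : realType) (P : probability T R)
    (xi : nat -> T -> R) (m : nat) (l : nat -> R) (w beta : R) :
  mutually_independent P xi -> (0 <= beta)%R ->
  (forall i, beta%:E <= P (xi i @^-1` `[l i, (l i + w)%R])) ->
  (beta ^+ m)%:E <=
    P [set x | forall i, (i < m)%N -> (l i <= xi i x <= l i + w)%R].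
Proof.
move=> [_ ind] b0 hb.
have := ind [fset i | i in iota 0 m]%fset (fun i => `[l i, (l i + w)%R]%classic)
  (fun i => measurable_itv _).
rewrite (_ : \bigcap_(i in _) _ =
  [set x | forall i, (i < m)%N -> (l i <= xi i x <= l i + w)%R]); last first.
  apply/seteqP; split => x /= H i => [im|].
    by have := H i; rewrite /= in_itv in_fset mem_iota; apply.
  by rewrite /= in_itv in_fset mem_iota => im; exact: H.
move=> ->; apply: le_trans (prode_ge _ b0 hb).
rewrite (_ : size _ = m)//.
by rewrite -[LHS]/(#|` [fset i | i in iota 0 m]|%fset) card_fseq undup_id ?iota_uniq// size_iota.
Qed.

Lemma disjoint_measure_ge d (T : measurableType d) (R : realType)
    (mu : {measure set T -> \bar R}) (I : finType) (S : {set I}) (A : I -> set T)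
    (m : R) :
  (forall i, measurable (A i)) ->
  (forall i j x, A i x -> A j x -> i = j) ->
  (forall i, m%:E <= mu (A i)) ->
  (#|S|%:R * m)%:E <= mu (\bigcup_(i in [set i | i \in S]) A i).
Proof.
move=> mA dA hm.
rewrite (_ : \bigcup_(i in _) _ = \big[setU/set0]_(l < #|S|) A (enum_val l)).
  rewrite measure_bigsetU_ord//; last first.
    by move=> i j _ _ [x [/= Ai Aj]]; apply: enum_val_inj; exact: dA Ai Aj.
  rewrite mulr_natl -[X in (_ *+ X)%R](card_ord #|S|) -sumr_const -sumEFin.
  by rewrite (eq_bigl xpredT)//; apply: lee_sum => i _; exact: hm.
rewrite -bigcup_seq; apply/seteqP; split => x [i /= iS Aix].
  by exists (enum_rank_in iS i); rewrite ?enum_rankK_in//= mem_index_enum.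
by exists (enum_val i) => //=; exact: enum_valP.
Qed.

End MeasureBounds.

(** * From sign flips to a lower bound on the risks *)

Section RiskLowerBound.
Context {R : realType} {X Y : hilbertType R}.
Variables (mu : probability (borel X) R) (p sigma : R).
Variables (gamma : probability (borel Y) R) (FF : set (X -> Y)).
Hypotheses (sepY : separable Y) (p1 : 1 <= p).
Local Open Scope ereal_scope.

Lemma measurable_noisy d (T : measurableType d) (f g : T -> Y) :
  measurable_fun setT (f : T -> borel Y) -> measurable_fun setT (g : T -> borel Y) ->
  measurable_fun setT ((fun t => f t + sigma *: g t)%R : T -> borel Y).
Proof.
move=> mf mg; apply: separable_measurable_add => //.
apply: (@measurableT_comp _ _ _ _ (borel Y) (borel Y) (fun y : Y => sigma *: y)%R) => //.
apply: continuous_borel_measurable; exact: scaler_continuous.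
Qed.

Lemma measurable_responses m (F : X -> Y) (x : m.-tuple X) :
  measurable_fun setT
    ((fun e => responses sigma F x e) : m.-tuple (borel Y) -> m.-tuple (borel Y)).
Proof.
apply/measurable_fun_tnthP => i.
rewrite (_ : _ \o _ =
    (fun e : m.-tuple (borel Y) => F (tnth x i) + sigma *: (tnth e i : Y))%R :> (_ -> Y)).
  apply: measurable_noisy; [exact: measurable_cst|exact: measurable_tnth].
by apply/funext => e; rewrite /= tnth_mktuple.
Qed.

Lemma measurable_observations m (F : X -> Y) : continuous F ->
  measurable_fun setT
    ((fun w => observations sigma F w.1 w.2) :
      m.-tuple (borel X) * m.-tuple (borel Y) -> m.-tuple (borel X * borel Y)%type).
Proof.
move=> cF; apply/measurable_fun_tnthP => i.
have mx : measurable_fun setT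
    ((fun w => tnth w.1 i) : m.-tuple (borel X) * m.-tuple (borel Y) -> borel X).
  exact: measurableT_comp (measurable_tnth i) measurable_fst.
have me : measurable_fun setT
    ((fun w => tnth w.2 i) : m.-tuple (borel X) * m.-tuple (borel Y) -> borel Y).
  exact: measurableT_comp (measurable_tnth i) measurable_snd.
rewrite (_ : _ \o _ = (fun w : m.-tuple (borel X) * m.-tuple (borel Y) =>
    (tnth w.1 i : borel X, (F (tnth w.1 i) + sigma *: (tnth w.2 i : Y))%R : borel Y))).
  apply: measurable_fun_pair => //; apply: measurable_noisy => //.
  apply: (@measurableT_comp _ _ _ _ (borel X) (borel Y) F) => //.
  exact: continuous_borel_measurable.
by apply/funext => w; rewrite /= !tnth_mktuple.
Qed.

Lemma measurable_normB (F G : X -> Y) : continuous F ->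
  measurable_fun setT (G : borel X -> borel Y) ->
  measurable_fun setT ((fun x => `|F x - G x|%R) : borel X -> R).
Proof.
move=> cF mG.
apply: (@measurableT_comp _ _ _ _ (borel Y) R (fun y : Y => `|y|%R)).
  apply: continuous_real_measurable; exact: norm_continuous.
apply: separable_measurable_add => //; first exact: continuous_borel_measurable.
apply: (@measurableT_comp _ _ _ _ (borel Y) (borel Y) (fun y : Y => - y)%R) => //.
apply: continuous_borel_measurable; exact: opp_continuous.
Qed.

(** Minkowski's inequality for [|F - G|] and [|F' - G|], whose sum dominates
    [|F - F'|]. *)
Lemma Lp_norm_two_point (F F' G : X -> Y) (A : set (borel X)) (t a : R) :
  continuous F -> continuous F' -> measurable_fun setT (G : borel X -> borel Y) ->
  measurable A -> (0 <= t)%R -> (0 <= a)%R ->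
  (forall x, A x -> (2 * t <= `|F x - F' x|)%R) -> a%:E <= mu A ->
  (2 * (t * a `^ p^-1))%:E <= Lp_norm mu p (F \- G)%R + Lp_norm mu p (F' \- G)%R.
Proof.
move=> cF cF' mG mA t0 a0 FF' aA.
have mF := measurable_normB cF mG; have mF' := measurable_normB cF' mG.
have p0 : (0 < p)%R by rewrite (lt_le_trans _ p1).
apply: le_trans (minkowski_EFin mu mF mF' p1).
pose g : borel X -> R := (fun x : borel X => `|F x - G x| + `|F' x - G x|)%R.
have H x : A x -> (2 * t <= `|g x|)%R.
  move=> Ax; rewrite ger0_norm ?addr_ge0// (le_trans (FF' _ Ax))//.
  rewrite [X in (_ <= _ + X)%R]distrC (le_trans _ (ler_normD _ _))//.
  by rewrite addrA subrK.
have mg : measurable_fun setT g by exact: measurable_funD.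
apply: le_trans (Lnorm_ge mu _ p0 mg mA H); last by rewrite mulr_ge0.
rewrite mulrA EFinM; apply: lee_wpmul2l; first by rewrite lee_fin mulr_ge0.
rewrite -poweR_EFin; apply: gt0_ler_poweR => //.
- by rewrite invr_ge0 ltW.
- by rewrite in_itv/= leey andbT lee_fin.
- by rewrite in_itv/= leey andbT.
Qed.

(* A finite family in which, for every design [x], the elements can be paired in
   such a way that partners agree on [x] but differ on a set of mass [a]. *)
Variables (I : finType) (i0 : I) (F : I -> X -> Y) (m : nat) (t a : R).
Hypotheses (FFF : forall i, FF (F i)) (cF : forall i, continuous (F i)).
Hypotheses (t0 : (0 <= t)%R) (a0 : (0 <= a)%R).
Hypothesis flips : forall x : m.-tuple X, exists flip : I -> I,
  injective flip /\ forall i, (forall l, F (flip i) (tnth x l) = F i (tnth x l)) /\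
    exists A : set (borel X), [/\ measurable A,
      forall z, A z -> (2 * t <= `|F i z - F (flip i) z|)%R & a%:E <= mu A].

Lemma fixed_design_risk_ge :
  (t * a `^ p^-1)%:E <= fixed_design_risk mu p sigma gamma FF m.
Proof.
apply: le_ereal_inf_tmp => _ [x _ <-]; apply: le_ereal_inf_tmp => _ [Fhat [mFhat mL] <-].
have [flip [flipI Hflip]] := flips x.
apply: (@flip_average _ _ _ (iid_law gamma m) _ i0
  (fun i e => Lp_norm mu p (F i \- Fhat (responses sigma (F i) x e))%R)
  (fun=> flip)) => //.
- move=> i; apply: (@measurableT_comp _ _ _ _ (m.-tuple (borel Y)) _
    (fun w => Lp_norm mu p (F i \- Fhat w)%R)); first exact: mL.
  exact: measurable_responses.
- by move=> i e; exact: Lnorm_ge0.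
- move=> e i; have [agree [A [mA HA aA]]] := Hflip i.
  have -> : responses sigma (F (flip i)) x e = responses sigma (F i) x e.
    by apply: eq_from_tnth => l; rewrite !tnth_mktuple agree.
  exact: (Lp_norm_two_point (@cF i) (@cF _) (mFhat _).1 mA t0 a0 HA aA).
- by move=> i; apply: ereal_sup_ubound; exists (F i).
Qed.

Lemma random_design_risk_ge :
  (t * a `^ p^-1)%:E <= random_design_risk mu p sigma gamma FF m.
Proof.
apply: le_ereal_inf_tmp => _ [nu _ <-]; apply: le_ereal_inf_tmp => _ [Fhat [mFhat mL] <-].
have /choice[flip Hflip] := flips.
apply: (@flip_average _ _ _ (iid_law nu m \x iid_law gamma m) _ i0
  (fun i w => Lp_norm mu p (F i \- Fhat (observations sigma (F i) w.1 w.2))%R)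
  (fun w => flip w.1)) => //.
- move=> i; apply: (@measurableT_comp _ _ _ _ (m.-tuple (borel X * borel Y)%type) _
    (fun w => Lp_norm mu p (F i \- Fhat w)%R)); first exact: mL.
  exact: measurable_observations.
- by move=> i e; exact: Lnorm_ge0.
- by move=> w; case: (Hflip w.1).
- move=> w i; have [agree [A [mA HA aA]]] := (Hflip w.1).2 i.
  have -> : observations sigma (F (flip w.1 i)) w.1 w.2 =
      observations sigma (F i) w.1 w.2.
    by apply: eq_from_tnth => l; rewrite !tnth_mktuple agree.
  exact: (Lp_norm_two_point (@cF i) (@cF _) (mFhat _).1 mA t0 a0 HA aA).
- by move=> i; apply: ereal_sup_ubound; exists (F i).
Qed.

End RiskLowerBound.

(** * Cells that contain no design point, and the mass of a cell *)

Section Flips.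
Context {R : realType} {X : hilbertType R} (d N k : nat) (e : 'I_d -> X).
Variables (psi : nat -> R -> R) (kappa : R).
Hypothesis pr : profile k psi kappa.

Local Notation cell := {ffun 'I_d -> 'I_N}.

Definition free_cells m (x : m.-tuple X) : {set cell} :=
  [set c | [forall l, cell_bump e psi c (tnth x l) [::] == 0]].

Definition flip_signs (S : {set cell}) (tau : {ffun cell -> bool}) :
    {ffun cell -> bool} := [ffun c => (c \in S) (+) tau c].

Lemma flip_signs_inj S : injective (flip_signs S).
Proof.
move=> tau tau' h; apply/ffunP => c; move/ffunP/(_ c): h.
by rewrite !ffunE; exact: addbI.
Qed.

(** Each design point activates at most one cell. *)
Lemma card_free_cells m (x : m.-tuple X) : (N ^ d <= #|free_cells x| + m)%N.
Proof.
have -> : (N ^ d)%N = #|{: cell}| by rewrite card_ffun !card_ord.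
rewrite -(cardsC (free_cells x)) leq_add2l -(ler_nat R).
rewrite [leRHS](_ : _ = \sum_(l < m) 1); last by rewrite sumr_const card_ord.
apply: le_trans (_ : \sum_(l < m) \sum_(c : cell)
    (cell_bump e psi c (tnth x l) [::] != 0)%:R <= _); last first.
  by apply: ler_sum => l _; exact: (sum_active N e pr).
rewrite exchange_big/= -sum1_card natr_sum big_mkcond/=; apply: ler_sum => c _.
rewrite !inE; case: forallP => /= [_|/forallP]; first exact: sumr_ge0.
rewrite negb_forall => /existsP[l hl].
by rewrite (bigD1 l)//= hl lerDl sumr_ge0.
Qed.

Lemma bump_sum_flip m (x : m.-tuple X) tau l :
  bump_sum e psi (flip_signs (free_cells x) tau) (tnth x l) [::] =
  bump_sum e psi tau (tnth x l) [::].
Proof.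
apply: eq_bigr => c _; rewrite !ffunE !inE; case: forallP => //= /(_ l)/eqP ->.
by rewrite !mulr0.
Qed.

(** The middle half of the cell in each coordinate, where the profile is at least
    [kappa]. *)
Definition cell_core (c : cell) : set X :=
  [set z | forall i, 4^-1 <= inner z (e i) - (c i)%:R <= 3 / 4].

Lemma bump_core c z : cell_core c z -> kappa ^+ d <= cell_bump e psi c z [::].
Proof.
move=> cz; rewrite /cell_bump -[X in _ ^+ X](card_ord d) -prodr_const.
apply: ler_prod => i _ /=; rewrite (ltW (profile_gt0 pr)).
exact: (profile_ge pr).
Qed.

Lemma bump_core_neq0 c z : cell_core c z -> cell_bump e psi c z [::] != 0.
Proof.
move=> cz; rewrite gt_eqF// (lt_le_trans _ (bump_core cz))//.
by rewrite exprn_gt0// (profile_gt0 pr).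
Qed.

Lemma cell_core_inj c c' z : cell_core c z -> cell_core c' z -> c = c'.
Proof. by move=> /bump_core_neq0 h /bump_core_neq0; exact: (bump_neq0_inj pr _ _ h). Qed.

Lemma bump_sum_core tau c z : cell_core c z ->
  bump_sum e psi tau z [::] = (-1) ^+ tau c * cell_bump e psi c z [::].
Proof.
move=> cz; rewrite /bump_sum (bigD1 c)//= big1 ?addr0// => c' c'c.
apply/eqP; rewrite mulf_eq0 signr_eq0/=; apply: contraNT c'c => h.
by apply/eqP; apply: (bump_neq0_inj pr _ _ h (bump_core_neq0 cz)).
Qed.

Lemma bump_sum_flip_core (S : {set cell}) tau c z : c \in S -> cell_core c z ->
  2 * kappa ^+ d <=
    `|bump_sum e psi tau z [::] - bump_sum e psi (flip_signs S tau) z [::]|.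
Proof.
move=> cS cz; rewrite !(bump_sum_core _ cz) ffunE cS addTb signrN.
rewrite mulNr opprK -mulr2n -mulrnAr normrM normr_sign mul1r.
rewrite normrMn -[leRHS]mulr_natl ler_wpM2l//.
by rewrite (le_trans (bump_core cz))// ler_norm.
Qed.

End Flips.

Section KlCells.
Context {R : realType} {X : hilbertType R} (mu : probability (borel X) R).
Variables (lambda : nat -> R) (phi : nat -> X) (nu : nat -> R -> R) (a b : R).
Hypotheses (a0 : 0 < a) (b0 : 0 < b).
Hypothesis ind : mutually_independent mu (kl_coord lambda phi).
Hypothesis dens : forall i, has_density mu (kl_coord lambda phi i) (nu i).
Hypothesis nub : forall i x, `|x| <= a -> b <= nu i x.
Variables (d N : nat).
Hypothesis N0 : (0 < N)%N.

(** Scaled so that [<x, cell_vector i>] runs through [[0, N]] when the [i]-th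
    Karhunen-Loeve coordinate of [x] runs through [[0, a]]. *)
Definition cell_vector (i : 'I_d) : X :=
  (N%:R / a / Num.sqrt (lambda i)) *: phi i.

Lemma inner_cell_vector x i :
  inner x (cell_vector i) = N%:R / a * kl_coord lambda phi i x.
Proof. by rewrite innerZr /kl_coord mulrAC -mulrA. Qed.

(** In each Karhunen-Loeve coordinate the core is an interval of length [a / (2 N)]
    inside [[0, a]], where the density is at least [b]. *)
Lemma cell_core_measure (c : {ffun 'I_d -> 'I_N}) :
  measurable (cell_core cell_vector c : set (borel X)) /\
  (((b * (a / (2 * N%:R))) ^+ d)%:E <= mu (cell_core cell_vector c))%E.
Proof.
have Np : 0 < N%:R :> R by rewrite ltr0n.
(* The corner of the cell, with dummy coordinates 0 beyond the first [d]. *)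
pose v (i : nat) : R := oapp (fun j : 'I_d => (c j)%:R) 0 (insub i).
have v01 i : 0 <= v i <= N%:R - 1.
  rewrite /v; case: insubP => [j _ _|_] /=; last first.
    by rewrite lexx subr_ge0 ler1n.
  by rewrite ler0n lerBrDr natr1 ler_nat ltn_ord.
pose l i := (v i + 4^-1) * (a / N%:R); pose w := a / (2 * N%:R).
pose xi := kl_coord lambda phi.
have -> : cell_core cell_vector c =
    [set x | forall i, (i < d)%N -> l i <= xi i x <= l i + w].
  have E (i : 'I_d) x : (4^-1 <= inner x (cell_vector i) - (c i)%:R <= 3 / 4) =
      (l i <= xi i x <= l i + w).
    have -> : (c i)%:R = v i by rewrite /v valK.
    rewrite inner_cell_vector -/(xi i x).
    have -> : l i + w = (v i + 3 / 4) * (a / N%:R).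
      by rewrite /l /w; field; rewrite gt_eqF.
    have aN : 0 < a / N%:R by rewrite divr_gt0.
    rewrite lerBrDr lerBlDr /l -!(ler_pdivlMr _ _ aN) -!(ler_pdivrMr _ _ aN).
    by rewrite invf_div mulrC (addrC (v i)) (addrC (3 / 4)) (mulrC (xi i x)).
  apply/seteqP; split => x /= H i; first by move=> im; rewrite -(E (Ordinal im)) H.
  by rewrite E H.
split.
  rewrite (_ : [set x | _] = \bigcap_(i in `I_d) (xi i @^-1` `[l i, l i + w])).
    apply: fin_bigcap_measurable => // i _; rewrite -[X in measurable X]setTI.
    by apply: ind.1 => //; exact: measurable_itv.
  by apply/seteqP; split => x /= H i im; have := H i im; rewrite /= in_itv.
apply: independent_box ind _ _; first by rewrite ltW// !(mulr_gt0, invr_gt0).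
move=> i; apply: (density_itv (dens i) (ltW b0) (nub i)).
- rewrite (@le_trans _ _ 0) ?oppr_le0 ?(ltW a0)// /l.
  have /andP[v0 _] := v01 i.
  by rewrite mulr_ge0 ?addr_ge0 ?divr_ge0// ltW.
- by rewrite ltW// !(mulr_gt0, invr_gt0).
- have -> : l i + w = (v i + 3 / 4) * (a / N%:R).
    by rewrite /l /w; field; rewrite gt_eqF.
  rewrite mulrA ler_pdivrMr// mulrC ler_pM2l//.
  by have /andP[_ v1] := v01 i; lra.
Qed.

End KlCells.

(** * A polynomial lower bound with arbitrary exponent *)

(** Growth along the subsequence [n ^ d] suffices for a limit superior. *)
Lemma limn_esup_pinfty (R : realType) (u : nat -> \bar R) (c : R) (d : nat) :
  0 < c -> (0 < d)%N ->
  (forall n, (0 < n)%N -> ((c * n%:R)%:E <= u (n ^ d)%N)%E) ->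
  limn_esup u = +oo%E.
Proof.
move=> c0 d0 hu; apply/eqP; rewrite -leye_eq; apply: le_ereal_inf_tmp => _ [V [M _ MV] <-].
rewrite leye_eq; apply/eqP; apply: eq_infty => t.
pose n := (maxn M.+1 (Num.truncn (t / c)).+1).
have n0 : (0 < n)%N by rewrite leq_max.
apply: (@le_trans _ _ (c * n%:R)%:E).
  rewrite lee_fin mulrC -ler_pdivrMr// ltW// (lt_le_trans (truncnS_gt _))//.
  by rewrite ler_nat leq_maxr.
apply: le_trans (hu n n0) _; apply: ereal_sup_ubound; exists (n ^ d)%N => //.
apply: MV => /=; rewrite (@leq_trans n)//; first by rewrite ltnW// leq_maxl.
by rewrite -[X in (X <= _)%N]expn1 leq_pexp2l.
Qed.

(** Otherwise the basis in which the trace is computed would be empty, and the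
    trace would be 0. *)
Lemma has_trace1_unit (R : realType) (Y : hilbertType R) (C : Y -> Y) :
  has_trace C 1 -> exists y : Y, `|y| = 1.
Proof.
move=> [D [e [[eD _]]]]; have [->|/set0P[i Di] _] := eqVneq D set0.
  by rewrite esum_set0 => /eqP; rewrite eqe eq_sym oner_eq0.
exists (e i); apply/eqP; rewrite -(@eqrXn2 _ 2)// expr1n -inner_norm eD//.
by rewrite eqxx.
Qed.

Section PolynomialLowerBound.
Context {R : realType} {X Y : hilbertType R}.
Variables (B sigma : R) (k : nat) (alpha p : R) (mu : probability (borel X) R).
Variables (lambda : nat -> R) (phi : nat -> X) (gamma : probability (borel Y) R).
Variables (nu : nat -> R -> R) (a b : R) (y : Y).
Hypotheses (sepY : separable Y) (B0 : 0 < B) (al0 : 0 < alpha) (al1 : alpha <= 1).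
Hypotheses (p1 : 1 <= p).
Hypothesis phi1 : forall i, `|phi i| = 1.
Hypothesis ind : mutually_independent mu (kl_coord lambda phi).
Hypotheses (a0 : 0 < a) (b0 : 0 < b).
Hypothesis dens : forall i, has_density mu (kl_coord lambda phi i) (nu i).
Hypothesis nub : forall i x, `|x| <= a -> b <= nu i x.
Hypothesis y1 : `|y| = 1.

(** The sign patterns of the bump sums form the finite family, and their
    restriction to the free cells of a design is what gets flipped. *)
Lemma risk_ge_poly (d : nat) : (0 < d)%N -> exists c : R, 0 < c /\
  forall n, (0 < n)%N ->
    ((c / n%:R ^+ k.+1)%:E <=
      fixed_design_risk mu p sigma gamma (C_ball k alpha B) (n ^ d))%E /\
    ((c / n%:R ^+ k.+1)%:E <=
      random_design_risk mu p sigma gamma (C_ball k alpha B) (n ^ d))%E.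
Proof.
move=> d0; have [psi [kappa pr]] := profile_exists R k.
have kp := profile_gt0 pr.
(* The cell vectors have norm at most [K = N K1]; the summand 1 makes [d K >= 1]. *)
pose K1 := 1 + \sum_(i < d) (a * Num.sqrt (lambda i))^-1.
have K1i (i : 'I_d) : (a * Num.sqrt (lambda i))^-1 <= K1.
  rewrite /K1 (bigD1 i)//= addrCA lerDl addr_ge0// sumr_ge0// => j _.
  by rewrite invr_ge0 mulr_ge0// ltW.
have K11 : 1 <= K1.
  by rewrite lerDl sumr_ge0// => j _; rewrite invr_ge0 mulr_ge0// ltW.
(* Mass of the free cores: at least [n ^ d] of them, each of mass at least
   [(a b / (4 n)) ^ d]. *)
pose m0 := (a * b / 4) ^+ d.
have m00 : 0 < m0 by rewrite !(divr_gt0, exprn_gt0, mulr_gt0).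
pose Q := d%:R * (2 * K1).
have Q0 : 0 < Q by rewrite !mulr_gt0 ?ltr0n// (lt_le_trans _ K11).
pose c := B / ((k.+3)%:R * Q ^+ k.+1) * kappa ^+ d * m0 `^ p^-1.
exists c; split.
  rewrite /c !(mulr_gt0, invr_gt0, exprn_gt0, powR_gt0)//; first by rewrite ltr0n.
  exact: lt_le_trans K11.
move=> n n0; pose N := (2 * n)%N; pose e := @cell_vector R X lambda phi a d N.
have N0 : (0 < N)%N by rewrite muln_gt0.
have nR : 1 <= n%:R :> R by rewrite ler1n.
pose K := N%:R * K1.
have K0 : 0 <= K by rewrite mulr_ge0// (le_trans _ K11).
have eK i : `|e i| <= K.
  rewrite /e /cell_vector normrZ phi1 mulr1 ger0_norm; last first.
    by rewrite !divr_ge0// ltW.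
  by rewrite -mulrA -invfM ler_wpM2l.
have dKE : d%:R * K = Q * n%:R.
  by rewrite /K /Q /N natrM; ring.
have dK1 : 1 <= d%:R * K.
  rewrite /K /N natrM; have dR : 1 <= d%:R :> R by rewrite ler1n.
  by rewrite -[leLHS]mulr1 ler_pM// -[leLHS]mulr1 ler_pM//; lra.
(* The largest height that the norm bound allows, up to
   [k + 1 + 2 d K <= (k + 3) d K]. *)
pose h := B / ((k.+3)%:R * (d%:R * K) ^+ k.+1).
have h0 : 0 <= h.
  by rewrite divr_ge0 ?(ltW B0)// mulr_ge0// exprn_ge0// (le_trans _ dK1).
pose F (tau : {ffun {ffun 'I_d -> 'I_N} -> bool}) (x : X) : Y :=
  (h * bump_sum e psi tau x [::]) *: y.
have FB tau : C_ball k alpha B (F tau).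
  apply: (bump_sum_C_ball pr K0 eK) => //.
  have dKp : 0 < d%:R * K by rewrite (lt_le_trans _ dK1).
  have -> : B = h * (d%:R * K) ^+ k * (k.+3%:R * (d%:R * K)).
    rewrite /h exprSr; field.
    by rewrite !gt_eqF ?exprn_gt0 ?ltr0n// mulr_gt0 ?ltr0n// (lt_le_trans _ K11).
  apply: ler_wpM2l; first by apply: mulr_ge0 => //; rewrite exprn_ge0// ltW.
  have -> : k.+3%:R = k.+1%:R + 2 :> R by rewrite -natrD addn2.
  by rewrite [leRHS]mulrDl lerD2r -[leLHS]mulr1 ler_wpM2l.
have cF tau : continuous (F tau).
  have -> : F tau = (fun t => t *: (h *: y)) \o (fun x => bump_sum e psi tau x [::]).
    by apply/funext => x; rewrite /F /= scalerA mulrC.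
  move=> x; apply: continuous_comp; last exact: scalel_continuous.
  exact: (bump_sum_continuous pr K0 eK).
have flips : forall x : (n ^ d).-tuple X, exists flip,
    injective flip /\ forall tau,
    (forall l, F (flip tau) (tnth x l) = F tau (tnth x l)) /\
    exists A : set (borel X), [/\ measurable A,
      forall z, A z -> 2 * (h * kappa ^+ d) <= `|F tau z - F (flip tau) z| &
      (m0%:E <= mu A)%E].
  move=> x; exists (flip_signs (free_cells N e psi x)); split.
    exact: flip_signs_inj.
  move=> tau; split=> [l|]; first by rewrite /F (bump_sum_flip e psi).
  pose S := free_cells N e psi x.
  exists (\bigcup_(c in [set c | c \in S]) cell_core e c); split.
  - apply: fin_bigcup_measurable => // c' _.
    exact: (cell_core_measure a0 b0 ind dens nub N0 _).1.
  - move=> z [c' /= cS cz]; rewrite /F -scalerBl normrZ y1 mulr1 -mulrBr normrM.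
    by rewrite (ger0_norm h0) mulrCA ler_wpM2l// (bump_sum_flip_core pr _ cS cz).
  - have cm (c1 : {ffun 'I_d -> 'I_N}) := cell_core_measure a0 b0 ind dens nub N0 c1.
    have disj (c1 c2 : {ffun 'I_d -> 'I_N}) (z : X) :=
      @cell_core_inj _ _ _ _ _ e _ _ pr c1 c2 z.
    have := disjoint_measure_ge S (fun c1 => (cm c1).1) disj (fun c1 => (cm c1).2).
    apply: le_trans; rewrite lee_fin.
    (* There are [N ^ d >= 2 n ^ d] cells and at most [n ^ d] of them are hit. *)
    have cS : (n ^ d)%:R <= #|S|%:R :> R.
      rewrite ler_nat -(leq_add2r (n ^ d)) (leq_trans _ (card_free_cells N e pr x))//.
      by rewrite addnn -mul2n /N expnMn leq_mul2r -{1}(expn1 2) leq_pexp2l// orbT.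
    have -> : m0 = (n ^ d)%:R * (b * (a / (2 * N%:R))) ^+ d.
      rewrite natrX -exprMn /m0 /N natrM; congr (_ ^+ d); field.
      by rewrite gt_eqF// ltr0n.
    rewrite ler_wpM2r// exprn_ge0// mulr_ge0 ?(ltW b0)// divr_ge0 ?(ltW a0)//.
have tc : c / n%:R ^+ k.+1 = h * kappa ^+ d * m0 `^ p^-1.
  rewrite /c /h dKE (exprMn _ Q).
  have : Q ^+ k.+1 != 0 by rewrite gt_eqF// exprn_gt0.
  have : n%:R ^+ k.+1 != 0 :> R by rewrite gt_eqF// exprn_gt0// ltr0n.
  have : k.+3%:R != 0 :> R by rewrite pnatr_eq0.
  move: (k.+3%:R) (n%:R ^+ k.+1) (Q ^+ k.+1) (kappa ^+ d) (m0 `^ _) => s1 s2 s3 s4 s5.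
  by move=> h1 h2 h3; field; rewrite h1 h2 h3.
rewrite tc; split.
- apply: (fixed_design_risk_ge sigma gamma sepY p1 [ffun=> false] FB cF _ _ flips).
    by rewrite mulr_ge0// exprn_ge0// ltW.
  exact: ltW.
- apply: (random_design_risk_ge sigma gamma sepY p1 [ffun=> false] FB cF _ _ flips).
    by rewrite mulr_ge0// exprn_ge0// ltW.
  exact: ltW.
Qed.

End PolynomialLowerBound.

(** * The curse of parametric complexity *)

Theorem proposition6p5 (R : realType) (X Y : hilbertType R)
  (sepX : separable X) (sepY : separable Y) (infX : infinite_dimensional X)
  (B sigma : R) (B_gt0 : 0 < B) (sigma_gt0 : 0 < sigma)
  (k : nat) (alpha : R) (alpha_gt0 : 0 < alpha) (alpha_le1 : alpha <= 1)
  (p : R) (p_ge1 : 1 <= p)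
  (mu : probability (borel X) R) (lambda : nat -> R) (phi : nat -> X)
  (mu_i : centred_square_integrable mu)
  (mu_ii_eigen : covariance_eigensystem mu lambda phi)
  (mu_ii_indep : mutually_independent mu (kl_coord lambda phi))
  (mu_iii_L : kl_density_lower mu lambda phi)
  (mu_iii_U : kl_moment_upper mu lambda phi p)
  (gamma : probability (borel Y) R) (Upsilon : Y -> Y)
  (gamma_gaussian : is_gaussian gamma) (gamma_mean : is_mean gamma 0)
  (gamma_cov : is_covariance gamma Upsilon) (Upsilon_trace : has_trace Upsilon 1)
  (q : R) (q_gt0 : 0 < q) :
  limn_esup (fun m => fixed_design_risk mu p sigma gamma (C_ball k alpha B) m
                      * (m%:R `^ q)%:E)%E = +oo%E
  /\
  limn_esup (fun m => random_design_risk mu p sigma gamma (C_ball k alpha B) m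
                      * (m%:R `^ q)%:E)%E = +oo%E.

Proof.
have [nu [a [b [a0 b0 dens nub]]]] := mu_iii_L.
case: mu_ii_eigen => _ _ [orth _] _.
have phi1 i : `|phi i| = 1.
  by apply/eqP; rewrite -(@eqrXn2 _ 2)// expr1n -inner_norm orth// eqxx.
have [y y1] := has_trace1_unit Upsilon_trace.
(* The least dimension with [d q > k + 2]. *)
pose d := (Num.truncn (k.+2%:R / q)).+1.
have [c [c0 Hc]] := risk_ge_poly sigma k gamma sepY B_gt0 alpha_gt0 alpha_le1 p_ge1
  phi1 mu_ii_indep a0 b0 dens nub y1 (d := d) isT.
have poly n : (0 < n)%N -> c * n%:R <= c / n%:R ^+ k.+1 * (n ^ d)%N%:R `^ q.
  move=> n0; have nR : 1 <= n%:R :> R by rewrite ler1n.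
  have np : 0 < n%:R :> R by rewrite ltr0n.
  rewrite -mulrA ler_pM2l// ler_pdivlMl ?exprn_gt0// -exprSr.
  rewrite natrX -!powR_mulrn ?ler0n// -powRrM ler_powR//.
  by rewrite -ler_pdivrMr// ltW// truncnS_gt.
split; apply: (@limn_esup_pinfty _ _ c d) => // n n0;
  have [fixed random] := Hc n n0.
- apply: (@le_trans _ _ ((c / n%:R ^+ k.+1)%:E * ((n ^ d)%N%:R `^ q)%:E)%E).
    by rewrite -EFinM lee_fin poly.
  by apply: lee_wpmul2r; rewrite ?lee_fin ?powR_ge0.
- apply: (@le_trans _ _ ((c / n%:R ^+ k.+1)%:E * ((n ^ d)%N%:R `^ q)%:E)%E).
    by rewrite -EFinM lee_fin poly.
  by apply: lee_wpmul2r; rewrite ?lee_fin ?powR_ge0.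
Qed.
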